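(* The geodesic space $(\mathcal M_0(\mathbb R^n),\mathsf{HK})$ does not admit any upper or lower curvature bound in the sense of Alexandrov: for no $\kappa\in\mathbb R$ does it have curvature $\ge\kappa$ in the sense of Alexandrov, and for no $\kappa\in\mathbb R$ does it have curvature $\le\kappa$ in the sense of Alexandrov.
   Context: $\mathbb R^n$ is $n$-dimensional Euclidean space, and $\mathcal M_0(\mathbb R^n)$ is the set of finite Borel measures on $\mathbb R^n$. Cone: $C=(\mathbb R^n\times[0,\infty))/\!\sim$, where $(x,r)\sim(x',r')$ iff they are equal or $r=r'=0$, with metric $d_C((x,r),(x',r'))^2=r^2+r'^2-2rr'\cos(\min(|x-x'|,\pi))$. $\mathcal M_2(C)$ (resp. $\mathcal M_2(C\times C)$) is the set of Borel measures integrating $1+$ squared distance to a fixed point. For $\nu\in\mathcal M_2(C)$ let $\Pr(\nu)(A)=\int_{A\times[0,\infty)}r^2\,d\nu(x,r)$. With $\pi_0,\pi_1:C\times C\to C$ the projections, the Hellinger-Kantorovich metric is $$\mathsf{HK}(\mu_0,\mu_1)=\inf\Big\{\int d_C^2\,dq:\ q\in\mathcal M_2(C\times C),\ \Pr((\pi_0)_*q)=\mu_0,\ \Pr((\pi_1)_*q)=\mu_1\Big\}^{1/2}.$$ Curvature bounds in the sense of Alexandrov are the usual ones, defined by triangle comparison with the model surface of constant curvature $\kappa$ (as in Burago-Burago-Ivanov).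
   Formalization: The absence of a lower curvature bound is stated for n ≥ 2 and the absence of an upper bound for n ≥ 1; outside these ranges the claim is false: over R the HK space has curvature ≥ 0, and over a point it is isometric to [0,∞). *)

(* Defs.v *)
From HB Require Import structures.
From mathcomp Require Import all_boot all_order all_algebra generic_quotient.
From mathcomp Require Import all_classical all_reals all_analysis.
Set Implicit Arguments.
Unset Strict Implicit.
Unset Printing Implicit Defensive.
Import Order.TTheory GRing.Theory Num.Theory.
Import numFieldNormedType.Exports.
Local Open Scope classical_set_scope.
Local Open Scope ring_scope.

(* 'rV[R]_n carries the sup norm in the library; it induces the usual topology,
   so the open sets below are those of Euclidean space. *)
Notation Rn R n := (g_sigma_algebraType (@open 'rV[R]_n)).

Definition edist (R : realType) n (x y : Rn R n) : R :=
  Num.sqrt (\sum_(i < n) ((x : 'rV[R]_n) 0 i - (y : 'rV[R]_n) 0 i) ^+ 2).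

Section Cone.
Variables (R : realType) (n : nat).

Local Notation precone := (Rn R n * {nonneg R})%type.

Definition cone_rel (p q : precone) : bool :=
  (p == q) || ((p.2%:num == 0) && (q.2%:num == 0)).

Lemma cone_rel_refl : reflexive cone_rel.
Proof. by move=> p; rewrite /cone_rel eqxx. Qed.

Lemma cone_rel_sym : symmetric cone_rel.
Proof. by move=> p q; rewrite /cone_rel eq_sym andbC. Qed.

Lemma cone_rel_trans : transitive cone_rel.
Proof.
move=> q p r /orP[/eqP -> //|/andP[p0 q0]] /orP[/eqP <-|/andP[_ r0]];
by rewrite /cone_rel ?p0 ?q0 ?r0 orbT.
Qed.

Canonical cone_equiv := EquivRel cone_rel cone_rel_refl cone_rel_sym cone_rel_trans.

Definition cone_quot := {eq_quot cone_rel}%qT.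
HB.instance Definition _ := EqQuotient.on cone_quot.
HB.instance Definition _ := Choice.on cone_quot.
HB.instance Definition _ :=
  isPointed.Build cone_quot (\pi_cone_quot ((point : Rn R n), 0%:nng))%qT.

(* The functions below are read off the chosen representative [repr p]; they
   do not depend on it, except for [cone_base] at the vertex, where every use
   of it is multiplied by a zero radius. *)
Definition cone_base (p : cone_quot) : Rn R n := (repr p).1.
Definition cone_radius (p : cone_quot) : R := (repr p).2%:num.

Definition cone_dist (p q : cone_quot) : R :=
  Num.sqrt (cone_radius p ^+ 2 + cone_radius q ^+ 2
    - 2 * cone_radius p * cone_radius q
        * cos (Num.min (edist (cone_base p) (cone_base q)) pi)).

Lemma cone_radius_pi (x : Rn R n) (r : {nonneg R}) :
  cone_radius (\pi_cone_quot (x, r))%qT = r%:num.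
Proof.
rewrite /cone_radius; have := reprK (\pi_cone_quot (x, r))%qT.
by move/eqmodP => /orP[/eqP -> //|/andP[/eqP -> /eqP /= ->]].
Qed.

Lemma cone_base_pi (x : Rn R n) (r : {nonneg R}) :
  r%:num != 0 -> cone_base (\pi_cone_quot (x, r))%qT = x.
Proof.
move=> r0; rewrite /cone_base; have := reprK (\pi_cone_quot (x, r))%qT.
by move/eqmodP => /orP[/eqP -> //|/andP[_ /= /eqP re]]; rewrite re eqxx in r0.
Qed.

Lemma cone_dist_pi (x y : Rn R n) (r s : {nonneg R}) :
  cone_dist (\pi_cone_quot (x, r))%qT (\pi_cone_quot (y, s))%qT
  = Num.sqrt (r%:num ^+ 2 + s%:num ^+ 2
      - 2 * r%:num * s%:num * cos (Num.min (edist x y) pi)).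
Proof.
rewrite /cone_dist !cone_radius_pi.
have [->|r0] := eqVneq r%:num 0; first by rewrite !(mulr0, mul0r).
have [->|s0] := eqVneq s%:num 0; first by rewrite !(mulr0, mul0r).
by rewrite !cone_base_pi.
Qed.

Definition cone_open : set (set cone_quot) :=
  [set U | forall p, U p ->
     exists2 e : R, 0 < e & forall q, cone_dist p q < e -> U q].

End Cone.

Notation cone R n := (g_sigma_algebraType (@cone_open R n)).

(* C * C carries the library's product sigma-algebra, which is its Borel
   sigma-algebra because the cone is separable. *)
Section HellingerKantorovich.
Variables (R : realType) (n : nat).
Local Notation C := (cone R n).
Local Open Scope ereal_scope.

Definition M2_cone_prod (q : set (C * C) -> \bar R) : Prop :=
  exists p0 : C * C,
    \int[q]_p (1 + (cone_dist p.1 p0.1 ^+ 2 + cone_dist p.2 p0.2 ^+ 2))%R%:E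
      < +oo.

(* The image of A * [0, oo[ in the cone. *)
Definition cone_over (A : set (Rn R n)) : set C :=
  [set (\pi_(cone_quot R n) xr)%qT | xr in A `*` [set: {nonneg R}]].

Definition Pr (nu : set C -> \bar R) (A : set (Rn R n)) : \bar R :=
  \int[nu]_(p in cone_over A) (cone_radius p ^+ 2)%:E.

Definition HK_admissible (mu0 mu1 : {finite_measure set (Rn R n) -> \bar R})
    (q : {measure set (C * C) -> \bar R}) : Prop :=
  [/\ M2_cone_prod q,
      forall A, measurable A -> Pr (pushforward q fst) A = mu0 A &
      forall A, measurable A -> Pr (pushforward q snd) A = mu1 A].

Definition HK (mu0 mu1 : {finite_measure set (Rn R n) -> \bar R}) : R :=
  Num.sqrt (fine (ereal_inf
    [set \int[q]_p (cone_dist p.1 p.2 ^+ 2)%R%:E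
    | q in [set q : {measure set (C * C) -> \bar R}
           | HK_admissible mu0 mu1 q]])).

End HellingerKantorovich.

Section Model.
Variable R : realType.
Implicit Types (k : R) (p q : 'rV[R]_3).

Definition euclid3 p q : R := p 0 0 * q 0 0 + p 0 1 * q 0 1 + p 0 2%:R * q 0 2%:R.
Definition lorentz3 p q : R := p 0 0 * q 0 0 + p 0 1 * q 0 1 - p 0 2%:R * q 0 2%:R.

Definition arcosh (x : R) : R := ln (x + Num.sqrt (x ^+ 2 - 1)).

(* The model surface of curvature k inside R^3: the sphere of radius 1/sqrt k,
   the plane, or the upper sheet of the hyperboloid <p, p> = 1/k for the
   Lorentz form. *)
Definition model_surface k : set 'rV[R]_3 :=
  [set p | if 0 < k then euclid3 p p = k^-1
           else if k < 0 then lorentz3 p p = k^-1 /\ 0 < p 0 2%:R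
           else p 0 2%:R = 0].

Definition model_dist k p q : R :=
  if 0 < k then acos (k * euclid3 p q) / Num.sqrt k
  else if k < 0 then arcosh (k * lorentz3 p q) / Num.sqrt (- k)
  else Num.sqrt (euclid3 (p - q) (p - q)).

End Model.

Section Alexandrov.
Variables (R : realType) (X : Type) (d : X -> X -> R).

Definition shortest_path (a b : X) (g : R -> X) : Prop :=
  [/\ g 0 = a, g 1 = b &
      forall s t, 0 <= s <= 1 -> 0 <= t <= 1 ->
        d (g s) (g t) = `|s - t| * d a b].

Definition path_in (U : set X) (g : R -> X) : Prop :=
  forall t, 0 <= t <= 1 -> U (g t).

(* [A, B, C] is a comparison triangle for the vertices [a, b, c], and [D] the
   point of the side [AC] corresponding to the point [x] of the side [ac]. *)
Definition comparison_config (k : R) (a b c x : X) (A B C D : 'rV[R]_3) : Prop :=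
  [/\ [/\ model_surface k A, model_surface k B, model_surface k C &
          model_surface k D],
      [/\ model_dist k A B = d a b, model_dist k B C = d b c &
          model_dist k A C = d a c] &
      model_dist k A D = d a x /\ model_dist k D C = d x c].

(* [cmp dist dist'] compares the distance from [b] to a point of the opposite
   side with the distance of the corresponding points in the model surface.
   A comparison triangle is unique up to isometry.  The underlying space is not
   required to be a length space: the failure of a bound is thus always a
   failure of the triangle comparison. *)
Definition triangle_comparison (cmp : rel R) (k : R) : Prop :=
  forall o : X, exists2 e : R, 0 < e &
    forall (a b c : X) (gab gbc gac : R -> X),
      shortest_path a b gab -> shortest_path b c gbc -> shortest_path a c gac ->
      path_in [set y | d o y < e] gab ->
      path_in [set y | d o y < e] gbc ->
      path_in [set y | d o y < e] gac ->
      (0 < k -> d a b + d b c + d a c < 2 * pi / Num.sqrt k) ->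
      forall t : R, 0 <= t <= 1 ->
      forall A B C D : 'rV[R]_3,
        comparison_config k a b c (gac t) A B C D ->
        cmp (d b (gac t)) (model_dist k B D).

Definition curvature_ge (k : R) : Prop := triangle_comparison (fun x y => y <= x) k.
Definition curvature_le (k : R) : Prop := triangle_comparison (fun x y => x <= y) k.

End Alexandrov.

(* Main.v *)
From Pilot Require Import Defs.
From HB Require Import structures.
From mathcomp Require Import all_boot all_order all_algebra generic_quotient.
From mathcomp Require Import all_classical all_reals all_analysis.
From mathcomp Require Import measurable_realfun ring lra.
Set Implicit Arguments.
Unset Strict Implicit.
Unset Printing Implicit Defensive.
Import Order.TTheory GRing.Theory Num.Theory.
Import numFieldNormedType.Exports Pilot.Defs.
Local Open Scope classical_set_scope.
Local Open Scope ring_scope.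

(** Near the zero measure the space of measures looks like the vertex of a cone,
    since multiplying masses by [s ^+ 2] multiplies [HK] by [s]; a triangle that
    violates the comparison with the plane does so in arbitrarily small copies,
    and these violate the comparison with the surface of any curvature [k].
    Both bounds are refuted by triangles of this kind, in every ball around the
    zero measure.

    Upper bounds fail because geodesics are not unique.  If [x] and [y] are at
    distance [pi / 2], the atoms of mass [s ^+ 2] at [x] and at [y] are joined by
    two shortest paths: one transports a single atom along the segment from [x]
    to [y], the other decreases the mass at [x] and increases the mass at [y]
    without transport.  Taking the midpoint of the second path as the third
    vertex gives a degenerate comparison triangle, whose height is zero, whereas
    the two midpoints are distinct ([not_curvature_le]).

    Lower bounds fail because the cone over a plane has sectional curvature
    [- 1 / r ^+ 2] at distance [r] from its vertex.  For single atoms at distance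
    at most [pi / 2], [HK] is the distance of the cone.  The triangle with atoms
    of mass [s ^+ 2] at [(0, 0)] and [(pi / 2, 0)] and an atom of mass
    [(s / 2) ^+ 2] at [(pi / 4, pi / 4)] has height [s / 2], and its comparison
    triangle in the plane has the square of its height equal to
    [s ^+ 2 * (3 / 4 - cos w)], where [w] is the distance from the third point to
    the other two; it is larger than [(s / 2) ^+ 2] since [cos w < 1 / 2], that
    is, [w > pi / 3] ([not_curvature_ge]).  For small [s] the height of the
    comparison triangle stays larger than [s / 2] in every model surface
    ([model_height_gt]).

    The values of [HK] on finitely supported measures come from explicit plans
    ([HK2_le_plan]) and from weak duality ([HK2_ge]): if
    [2 * r * s * cos d <= f * r ^+ 2 + g * s ^+ 2] at the supports, then
    [(1 - f) * r ^+ 2 + (1 - g) * s ^+ 2] is at most the squared distance of the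
    cone almost everywhere for every admissible plan, and it integrates to a
    quantity that depends only on the two measures. *)

(** * Euclidean distance and geometry of the cone *)

Lemma ler_cos (R : realType) :
  {in `[0, pi] &, {mono (@cos R) : x y /~ y <= x}}.
Proof. by move=> x y xI yI; rewrite !leNgt ltr_cos. Qed.

Section EuclideanDistance.
Variables (R : realType) (n : nat).
Implicit Types x y : Rn R n.

Lemma edist_ge0 x y : 0 <= edist x y.
Proof. exact: sqrtr_ge0. Qed.

Lemma edist_coord x y i :
  `|(x : 'rV[R]_n) 0 i - (y : 'rV[R]_n) 0 i| <= edist x y.
Proof.
rewrite -sqrtr_sqr ler_sqrt; last by apply: sumr_ge0 => j _; exact: sqr_ge0.
by rewrite (bigD1 i)//= lerDl sumr_ge0// => j _; exact: sqr_ge0.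
Qed.

Lemma edist_line (x y : 'rV[R]_n) (a b : R) :
  edist (x + a *: (y - x) : Rn R n) (x + b *: (y - x) : Rn R n)
  = `|a - b| * edist (x : Rn R n) (y : Rn R n).
Proof.
rewrite /edist -sqrtr_sqr -sqrtrM ?sqr_ge0//; congr (Num.sqrt _).
by rewrite mulr_sumr; apply: eq_bigr => i _; rewrite !mxE; ring.
Qed.

(** A point close to [x] for the Euclidean distance is close for the norm
    that defines the topology. *)
Lemma edist_nbhs (U : set 'rV[R]_n) (x : 'rV[R]_n) : open U -> U x ->
  exists2 e : R, 0 < e & forall y : 'rV[R]_n, edist (x : Rn R n) (y : Rn R n) < e -> U y.
Proof.
move=> oU Ux; have /nbhs_ballP[e e0 xeU] : nbhs x U by exact: open_nbhs_nbhs.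
exists e => // y xy; apply: xeU.
split=> // i j; rewrite (ord1 i) /ball/=.
by apply: le_lt_trans xy; exact: edist_coord.
Qed.

End EuclideanDistance.

Section ConeGeometry.
Variables (R : realType) (n : nat).
Local Notation C := (cone R n).
Implicit Types (p q : C) (A : set (Rn R n)).

(** The cosine of the angle under which the vertex sees two points, the angle
    being truncated at [pi]; arbitrary if one of the points is the vertex. *)
Definition cone_cos p q : R :=
  cos (Num.min (edist (cone_base p) (cone_base q)) pi).

Lemma cone_radius_ge0 p : 0 <= cone_radius p.
Proof. by rewrite /cone_radius. Qed.

Lemma cone_dist_sqr p q :
  cone_dist p q ^+ 2 = cone_radius p ^+ 2 + cone_radius q ^+ 2
    - 2 * cone_radius p * cone_radius q * cone_cos p q.
Proof.
rewrite /cone_dist sqr_sqrtr// -/(cone_cos p q).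
have c1 : cone_cos p q <= 1 by exact: cos_le1.
have := cone_radius_ge0 p; have := cone_radius_ge0 q.
move: (cone_radius p) (cone_radius q) (cone_cos p q) c1 => r s c c1 s0 r0.
have : 0 <= (1 - c) * (r * s) by rewrite mulr_ge0 ?subr_ge0// mulr_ge0.
have := sqr_ge0 (r - s); nra.
Qed.

Lemma cone_dist_radius p q :
  `|cone_radius p - cone_radius q| <= cone_dist p q.
Proof.
rewrite -(@ler_sqr _ _ (cone_dist p q)) ?nnegrE ?sqrtr_ge0//.
rewrite real_normK ?num_real// cone_dist_sqr.
have c1 : cone_cos p q <= 1 by exact: cos_le1.
have := cone_radius_ge0 p; have := cone_radius_ge0 q.
move: (cone_radius p) (cone_radius q) (cone_cos p q) c1 => r s c c1 s0 r0.
have : 0 <= (1 - c) * (r * s) by rewrite mulr_ge0 ?subr_ge0// mulr_ge0.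
nra.
Qed.

(** Away from the vertex, points of the cone that are close have close bases. *)
Lemma cone_base_near p (e : R) : 0 < cone_radius p -> 0 < e ->
  exists2 d : R, 0 < d & forall q, cone_dist p q < d ->
    0 < cone_radius q /\ edist (cone_base p) (cone_base q) < e.
Proof.
move=> r0 e0.
pose e' := Num.min e pi; have pi0 := @pi_gt0 R.
have e'0 : 0 < e' by rewrite /e' lt_min e0 pi0.
have e'pi : e' <= pi by rewrite /e' ge_min lexx orbT.
pose c := Num.max 0 (cos e').
have c0 : 0 <= c by rewrite /c le_max lexx.
have c1 : c < 1.
  rewrite /c gt_max ltr01/= -cos0 ltr_cos// in_itv/= ?lexx ?(ltW pi0)//.
  by rewrite (ltW e'0).
(* A point of radius [s] at an angle of cosine at most [c] is at squared distance
   at least [r ^+ 2 + s ^+ 2 - 2 * r * s * c >= r ^+ 2 * (1 - c ^+ 2)]. *)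
pose d2 := cone_radius p ^+ 2 * (1 - c ^+ 2).
have d20 : 0 < d2.
  by rewrite mulr_gt0 ?exprn_gt0// subr_gt0 expr_lt1.
exists (Num.sqrt d2); first by rewrite sqrtr_gt0.
move=> q pq.
have pq2 : cone_dist p q ^+ 2 < d2.
  rewrite -(@sqr_sqrtr _ d2) ?(ltW d20)// ltr_sqr// nnegrE ?sqrtr_ge0//.
have s0 := cone_radius_ge0 q.
split.
  rewrite lt0r s0 andbT; apply/negP => /eqP s0'.
  move: pq2; rewrite cone_dist_sqr s0' /d2 => h.
  have := mulr_ge0 (sqr_ge0 (cone_radius p)) (sqr_ge0 c); nra.
rewrite ltNge; apply/negP => le.
have cc : cone_cos p q <= c.
  rewrite /c le_max; apply/orP; right; rewrite /cone_cos ler_cos//.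
  - by rewrite le_min e'pi andbT (le_trans _ le)// ge_min lexx.
  - by rewrite in_itv/= (ltW e'0).
  - by rewrite in_itv/= le_min (ltW pi0) edist_ge0/= ge_min lexx orbT.
move: pq2; rewrite cone_dist_sqr /d2.
move: (cone_radius p) r0 (cone_radius q) s0 (cone_cos p q) cc => r r0 s s0 k kc.
have : 0 <= (c - k) * (r * s) by rewrite mulr_ge0 ?subr_ge0// mulr_ge0// ltW.
have := sqr_ge0 (s - r * c); nra.
Qed.

(** * Measurability on the cone *)

Lemma measurable_cone_open (U : set C) : cone_open U -> measurable U.
Proof. exact: sub_sigma_algebra. Qed.

Lemma measurable_cone_radius : measurable_fun setT (@cone_radius R n : C -> R).
Proof.
apply: (measurability _ (RGenInftyO.measurableE R)) => //.
move=> _ [_ [a ->] <-]; rewrite setTI; apply: measurable_cone_open => p /=.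
rewrite in_itv/= => pa; exists (a - cone_radius p); first by rewrite subr_gt0.
move=> q /=; rewrite in_itv/=; have := cone_dist_radius p q.
by rewrite ler_norml => /andP[+ _]; lra.
Qed.

(** The points of the cone other than the vertex. *)
Definition punctured : set C := [set p | 0 < cone_radius p].

Lemma measurable_punctured : measurable punctured.
Proof.
rewrite (_ : punctured = (@cone_radius R n) @^-1` `]0, +oo[%classic).
  by rewrite -[X in measurable X]setTI; exact: measurable_cone_radius.
by apply/seteqP; split => p /=; rewrite in_itv/= andbT.
Qed.

(** The base is measurable away from the vertex only, where it is continuous;
    at the vertex it is an arbitrary representative. *)
Lemma measurable_cone_base : measurable_fun punctured (@cone_base R n : C -> Rn R n).
Proof.
refine (@measurability _ _ C (Rn R n) punctured (@cone_base R n) (@open (matrix R 1 n)) _ _) => //.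
move=> _ [U oU <-]; apply: measurable_cone_open => p [/= p0 Up].
have [e e0 eU] := edist_nbhs oU Up.
have [d d0 dp] := cone_base_near p0 e0.
by exists d => // q /dp[q0 pq]; split => //=; exact: eU.
Qed.





(** The cone over a nonempty set contains the vertex, whatever the base chosen
    to represent it. *)
Lemma cone_overE A : A !=set0 ->
  cone_over A = (punctured `&` (@cone_base R n) @^-1` A) `|` ~` punctured.
Proof.
move=> [x0 Ax0]; apply/seteqP; split => [_ [[x r] [/= Ax _] <-]|p].
  have [r0|r0] := eqVneq r%:num 0.
    by right; rewrite /punctured /= cone_radius_pi r0 ltxx.
  left; split; first by rewrite /punctured/= cone_radius_pi lt0r r0 /=.
  by rewrite /= cone_base_pi.
move=> [[/= p0 Ap]|/negP].
  exists (repr (p : cone_quot R n)); first by split.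
  by rewrite reprK.
rewrite -leNgt => p0; exists (x0, 0%:nng); first by split.
rewrite -[RHS]reprK; apply/eqmodP; apply/orP; right => /=; rewrite eqxx/=.
by rewrite eq_le -/(cone_radius p) p0 cone_radius_ge0.
Qed.

Lemma measurable_cone_over A : measurable A -> measurable (cone_over A).
Proof.
move=> mA; have [->|/set0P A0] := eqVneq A set0.
  rewrite (_ : cone_over set0 = set0)//.
  by apply/seteqP; split => // p [? []].
rewrite cone_overE//; apply: measurableU.
  by apply: measurable_cone_base => //; exact: measurable_punctured.
by apply: measurableC; exact: measurable_punctured.
Qed.

(** The mass that a unit atom at [p] contributes to [Pr _ A]. *)
Definition weight A p : \bar R := ((cone_radius p ^+ 2)%:E * \d_(cone_base p) A)%E.

Lemma weightE A :
  weight A = (fun p => (cone_radius p ^+ 2)%:E) \_ (cone_over A).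
Proof.
apply/funext => p; rewrite /weight /patch.
have [p0|/negP p0] := boolP (0 < cone_radius p); last first.
  have -> : cone_radius p = 0.
    by apply/eqP; rewrite eq_le cone_radius_ge0 andbT leNgt; exact/negP.
  by rewrite expr0n/= mul0e; case: ifP.
have [A0|/set0P A0] := eqVneq A set0.
  rewrite A0 dirac0 mule0; case: ifPn => // /set_mem[? []]//.
rewrite cone_overE// diracE.
have [Ap|Ap] := boolP (cone_base p \in A).
  by rewrite mem_set ?mule1//; left; split => //=; exact: set_mem.
rewrite mule0 memNset//= => -[[_ /mem_set]|]; [exact/negP|exact].
Qed.

Lemma weight_ge0 A p : (0 <= weight A p)%E.
Proof. by rewrite mule_ge0// lee_fin sqr_ge0. Qed.

Lemma measurable_weight A : measurable A -> measurable_fun setT (weight A : C -> \bar R).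
Proof.
move=> mA; rewrite weightE; apply/(measurable_restrictT _ _).1.
  exact: measurable_cone_over.
apply: measurable_funTS; apply/measurable_EFinP.
by apply: measurable_funX; exact: measurable_cone_radius.
Qed.

(** The vertex; the base of its representative is irrelevant. *)
Definition cone_vertex : C := (\pi_(cone_quot R n) (point : Rn R n, 0%:nng))%qT.

End ConeGeometry.

(** * Transport plans with finitely many atoms *)

Section Plans.
Variables (R : realType) (n : nat).
Local Notation C := (cone R n).
Local Open Scope ereal_scope.
Implicit Types (mu nu : {finite_measure set (Rn R n) -> \bar R}) (s : seq (C * C)).

Lemma Pr_pushforward (q : {measure set (C * C) -> \bar R}) (f : C * C -> C) A :
  measurable_fun setT f -> measurable A ->
  Pr (pushforward q f) A = \int[q]_p weight A (f p).
Proof.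
move=> mf mA; rewrite /Pr ge0_integral_pushforward//; last 3 first.
- exact: measurable_cone_over.
- apply: measurable_funTS; apply/measurable_EFinP.
  by apply: measurable_funX; exact: measurable_cone_radius.
- by move=> p _; rewrite lee_fin sqr_ge0.
by rewrite integral_mkcond weightE.
Qed.

(** The transport plan that puts a unit atom at each entry of a sequence of
    pairs of points of the cone. *)
Definition plan s : set (C * C) -> \bar R :=
  msum (fun i => \d_(nth (cone_vertex R n, cone_vertex R n) s i)) (size s).

HB.instance Definition _ s := Measure.on (plan s).

Lemma integral_plan s (f : C * C -> \bar R) :
  (forall p, 0 <= f p) -> measurable_fun setT f ->
  \int[plan s]_p f p = \sum_(p <- s) f p.
Proof.
move=> f0 mf; rewrite ge0_integral_measure_sum//.
rewrite (big_nth (cone_vertex R n, cone_vertex R n)) big_mkord.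
by apply: eq_bigr => i _; rewrite integral_dirac// diracT mul1e.
Qed.

Import HBNNSimple.

(** Integrals of non-negative functions are suprema of integrals of simple
    functions below them; this bound needs no measurability of [f]. *)
Lemma integral_plan_le s (f : C * C -> \bar R) : (forall p, 0 <= f p) ->
  \int[plan s]_p f p <= \sum_(p <- s) f p.
Proof.
move=> f0; rewrite ge0_integralTE//; apply: ge_ereal_sup => _ [h hf <-].
rewrite -integralT_nnsfun integral_plan//.
- by apply: lee_sum => p _; exact: hf.
- by move=> p; rewrite lee_fin; exact: fun_ge0.
- exact/measurable_EFinP.
Qed.

(** The infimum whose square root is [HK]. *)
Definition HK2 mu nu : \bar R := ereal_inf
  [set \int[q]_p (cone_dist p.1 p.2 ^+ 2)%R%:E
  | q in [set q : {measure set (C * C) -> \bar R} | HK_admissible mu nu q]].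

Lemma HKE mu nu : HK mu nu = Num.sqrt (fine (HK2 mu nu)).
Proof. by []. Qed.

Lemma HK2_ge0 mu nu : 0 <= HK2 mu nu.
Proof.
apply: le_ereal_inf_tmp => _ [q _ <-]; apply: integral_ge0 => p _.
by rewrite lee_fin sqr_ge0.
Qed.

Lemma HK2_le_plan mu nu s :
  (forall A, measurable A -> mu A = \sum_(p <- s) weight A p.1) ->
  (forall A, measurable A -> nu A = \sum_(p <- s) weight A p.2) ->
  HK2 mu nu <= (\sum_(p <- s) cone_dist p.1 p.2 ^+ 2)%R%:E.
Proof.
move=> smu snu.
apply: (@le_trans _ _ (\int[plan s]_p (cone_dist p.1 p.2 ^+ 2)%R%:E)); last first.
  rewrite -sumEFin.
  apply: (@integral_plan_le s (fun p => (cone_dist p.1 p.2 ^+ 2)%R%:E)) => p.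
  by rewrite lee_fin sqr_ge0.
apply: ereal_inf_lbound; exists (plan s) => //; split.
- exists (cone_vertex R n, cone_vertex R n) => /=.
  apply: le_lt_trans (integral_plan_le _ _) _ => [p|].
    by rewrite lee_fin !addr_ge0// ?sqr_ge0.
  by rewrite sumEFin ltry.
- move=> A mA; rewrite Pr_pushforward//.
  rewrite smu// integral_plan//; first by move=> p; exact: weight_ge0.
  exact: (measurableT_comp (measurable_weight mA) measurable_fst).
- move=> A mA; rewrite Pr_pushforward//.
  rewrite snu// integral_plan//; first by move=> p; exact: weight_ge0.
  exact: (measurableT_comp (measurable_weight mA) measurable_snd).
Qed.

End Plans.

(** * Weak duality *)

(** The integral is monotone on non-negative functions even when they are not
    measurable. *)
Lemma ge0_le_integral_nomeas d (T : measurableType d) (R : realType)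
    (m : {measure set T -> \bar R}) (f g : T -> \bar R) :
  (forall x, (0 <= f x)%E) -> (forall x, (f x <= g x)%E) ->
  (\int[m]_x f x <= \int[m]_x g x)%E.
Proof.
move=> f0 fg; have g0 x : (0 <= g x)%E by exact: le_trans (fg x).
rewrite !ge0_integralTE//; apply: ge_ereal_sup => _ [h hf <-].
by apply: ereal_sup_ubound; exists h => // x; exact: le_trans (fg x).
Qed.

Section WeakDuality.
Variables (R : realType) (n : nat).
Local Notation C := (cone R n).
Implicit Types (mu nu : {finite_measure set (Rn R n) -> \bar R}).
Implicit Types (xs ys : seq (Rn R n)) (f g : Rn R n -> R).

Lemma measurable_Rn1 (x : Rn R n) : measurable [set x].
Proof.
rewrite -[X in measurable X]setCK; apply: measurableC.
apply: sub_sigma_algebra; rewrite openC.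
by apply: (@accessible_closed_set1 'rV[R]_n); apply: hausdorff_accessible; exact: norm_hausdorff.
Qed.

Lemma measurable_Rn_seq xs : measurable [set` xs].
Proof.
elim: xs => [|x xs ih].
  by rewrite (_ : [set` [::]] = set0)//; apply/seteqP; split.
rewrite (_ : [set` x :: xs] = [set x] `|` [set` xs]).
  by apply: measurableU => //; exact: measurable_Rn1.
apply/seteqP; split => y /=; rewrite in_cons; first by move/predU1P.
by move=> ?; apply/predU1P.
Qed.

(** A potential given by [f] on the points [xs] and by the constant [M]
    elsewhere, as a 2-homogeneous function on the cone. *)
Definition potential f xs (M : R) (p : C) : R :=
  (if cone_base p \in xs then f (cone_base p) else M) * cone_radius p ^+ 2.

Lemma potentialE f xs M p : uniq xs ->
  (potential f xs M p)%:E =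
  (\sum_(x <- xs) (f x)%:E * weight [set x] p + M%:E * weight (~` [set` xs]) p)%E.
Proof.
move=> uxs; rewrite /potential /weight !diracE.
have [pxs|pxs] := boolP (cone_base p \in xs).
  rewrite (bigD1_seq (cone_base p))//= big_seq_cond big1 => [|x /andP[_ xp]].
    by rewrite memNset/= ?mule0 ?adde0 ?diracE ?mem_set ?mule1 ?EFinM//= => /(_ pxs).
  by rewrite diracE memNset ?mule0//= => px; rewrite px eqxx in xp.
rewrite big_seq big1 ?add0e.
  by rewrite mem_set/= ?mule1//; exact/negP.
move=> x xxs; rewrite diracE memNset ?mule0//= => px.
by rewrite px xxs in pxs.
Qed.

Lemma potential_ge0 f xs M p : (forall x, 0 <= f x) -> 0 <= M ->
  0 <= potential f xs M p.
Proof. by move=> f0 M0; rewrite mulr_ge0 ?sqr_ge0//; case: ifP. Qed.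

Lemma measurable_potential f xs M : uniq xs ->
  measurable_fun setT (potential f xs M : C -> R).
Proof.
move=> uxs; apply/measurable_EFinP.
rewrite (_ : EFin \o _ = fun p : C => (\sum_(x <- xs) (f x)%:E * weight [set x] p
    + M%:E * weight (~` [set` xs]) p)%E); last first.
  by apply/funext => p /=; rewrite potentialE.
apply: emeasurable_funD.
  apply: emeasurable_sum => x; apply: emeasurable_funM => //.
  by apply: measurable_weight; exact: measurable_Rn1.
apply: emeasurable_funM => //; apply: measurable_weight.
by apply: measurableC; exact: measurable_Rn_seq.
Qed.

Lemma integral_potential (q : {measure set (C * C) -> \bar R}) (e : C * C -> C)
    (mu : {finite_measure set (Rn R n) -> \bar R}) f xs M :
  measurable_fun setT e -> uniq xs -> (forall x, 0 <= f x) -> 0 <= M ->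
  (forall A, measurable A -> Pr (pushforward q e) A = mu A) ->
  mu (~` [set` xs]) = 0%E ->
  (\int[q]_p (potential f xs M (e p))%:E =
   (\sum_(x <- xs) f x * fine (mu [set x]))%:E)%E.
Proof.
move=> me uxs f0 M0 emu mu0.
have mw A : measurable A -> measurable_fun setT (weight A \o e).
  by move=> mA; exact: (measurableT_comp (measurable_weight mA)).
under eq_integral do rewrite potentialE//.
rewrite ge0_integralD//=; first last.
- apply: emeasurable_funM => //; apply: mw.
  by apply: measurableC; exact: measurable_Rn_seq.
- by move=> p _; rewrite mule_ge0 ?weight_ge0.
- apply: emeasurable_sum => x; apply: emeasurable_funM => //.
  by apply: mw; exact: measurable_Rn1.
- by move=> p _; apply: sume_ge0 => x _; rewrite mule_ge0 ?weight_ge0// lee_fin.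
have iw A : measurable A -> (\int[q]_p weight A (e p) = mu A)%E.
  by move=> mA; rewrite -Pr_pushforward// emu.
rewrite ge0_integralZl//; last 2 first.
- by apply: mw; apply: measurableC; exact: measurable_Rn_seq.
- by move=> p _; exact: weight_ge0.
rewrite iw ?mu0 ?mule0 ?adde0; last by apply: measurableC; exact: measurable_Rn_seq.
rewrite ge0_integral_sum//; last 2 first.
- move=> x; apply: emeasurable_funM => //.
  by apply: mw; exact: measurable_Rn1.
- by move=> x p _; rewrite mule_ge0 ?weight_ge0// lee_fin.
rewrite -sumEFin; apply: eq_bigr => x _.
rewrite ge0_integralZl//; last 3 first.
- by apply: mw; exact: measurable_Rn1.
- by move=> p _; exact: weight_ge0.
- by rewrite lee_fin.
rewrite iw; last exact: measurable_Rn1.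
rewrite EFinM fineK//; apply: fin_num_measure; exact: measurable_Rn1.
Qed.

(** The potentials [f] and [g] matter on the supports only: elsewhere they are
    replaced by a constant [M] so large that the inequality holds with [cos]
    bounded by [1]. *)
Lemma HK2_ge mu nu xs ys f g :
  uniq xs -> uniq ys ->
  mu (~` [set` xs]) = 0%E -> nu (~` [set` ys]) = 0%E ->
  (forall x, 0 < f x) -> (forall y, 0 < g y) ->
  (forall x y r s, x \in xs -> y \in ys -> 0 <= r -> 0 <= s ->
    2 * r * s * cos (Num.min (edist x y) pi) <= f x * r ^+ 2 + g y * s ^+ 2) ->
  ((fine (mu setT) + fine (nu setT)
     - \sum_(x <- xs) f x * fine (mu [set x])
     - \sum_(y <- ys) g y * fine (nu [set y]))%:E <= HK2 mu nu)%E.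
Proof.
move=> uxs uys mu0 nu0 f0 g0 fg.
have f0' x : 0 <= f x by exact: ltW.
have g0' x : 0 <= g x by exact: ltW.
pose M := 1 + \sum_(x <- xs) (f x)^-1 + \sum_(y <- ys) (g y)^-1.
have S1 : 0 <= \sum_(x <- xs) (f x)^-1 by apply: sumr_ge0 => x _; rewrite invr_ge0.
have S2 : 0 <= \sum_(y <- ys) (g y)^-1 by apply: sumr_ge0 => x _; rewrite invr_ge0.
have M1 : 1 <= M by rewrite /M -addrA lerDl addr_ge0.
have M0 : 0 <= M by exact: le_trans M1.
have Mf x : x \in xs -> 1 <= f x * M.
  move=> xxs; rewrite mulrC -ler_pdivrMr// div1r /M addrAC.
  rewrite (big_rem x xxs)/= addrCA lerDl !addr_ge0//.
  by apply: sumr_ge0 => y _; rewrite invr_ge0.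
have Mg x : x \in ys -> 1 <= g x * M.
  move=> xxs; rewrite mulrC -ler_pdivrMr// div1r /M.
  rewrite (big_rem x xxs)/= addrCA lerDl !addr_ge0//.
  by apply: sumr_ge0 => y _; rewrite invr_ge0.
pose P := potential f xs M; pose Q := potential g ys M.
have key (p q : C) :
    2 * cone_radius p * cone_radius q * cone_cos p q <= P p + Q q.
  rewrite /P /Q /potential /cone_cos.
  have := cone_radius_ge0 p; have := cone_radius_ge0 q.
  have := cos_le1 (Num.min (edist (cone_base p) (cone_base q)) pi).
  move: (cone_radius p) (cone_radius q) => r s c1 s0 r0.
  have AG a b : 0 < a -> 0 < b -> 1 <= a * b ->
      2 * r * s * cos (Num.min (edist (cone_base p) (cone_base q)) pi)
        <= a * r ^+ 2 + b * s ^+ 2.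
    move=> a0 b0 ab.
    apply: (@le_trans _ _ (2 * r * s)).
      by rewrite ler_piMr// !mulr_ge0.
    rewrite -(ler_pM2l a0).
    have := sqr_ge0 (a * r - s).
    have : 0 <= (a * b - 1) * s ^+ 2 by rewrite mulr_ge0 ?subr_ge0// sqr_ge0.
    nra.
  have M0' : 0 < M by exact: lt_le_trans M1.
  case: ifPn => pxs; case: ifPn => qys.
  - exact: fg.
  - by apply: AG => //; exact: Mf.
  - by apply: AG => //; rewrite mulrC; exact: Mg.
  - by apply: AG => //; rewrite -[1]mulr1 ler_pM.
apply: le_ereal_inf_tmp => _ [q [_ qmu qnu] <-].
(* [h] is a measurable function below the squared distance, so that the
   measurability of the latter is not needed. *)
pose h (p : C * C) : R := Num.max 0
  (cone_radius p.1 ^+ 2 + cone_radius p.2 ^+ 2 - (P p.1 + Q p.2)).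
have hd p : h p <= cone_dist p.1 p.2 ^+ 2.
  rewrite /h ge_max sqr_ge0/= cone_dist_sqr lerD2l lerN2; exact: key.
have mP : measurable_fun setT (fun p : C * C => P p.1).
  exact: (measurableT_comp (measurable_potential f M uxs) measurable_fst).
have mQ : measurable_fun setT (fun p : C * C => Q p.2).
  exact: (measurableT_comp (measurable_potential g M uys) measurable_snd).
have mr1 : measurable_fun setT (fun p : C * C => cone_radius p.1 ^+ 2).
  apply: measurable_funX.
  exact: (measurableT_comp (@measurable_cone_radius R n) measurable_fst).
have mr2 : measurable_fun setT (fun p : C * C => cone_radius p.2 ^+ 2).
  apply: measurable_funX.
  exact: (measurableT_comp (@measurable_cone_radius R n) measurable_snd).
have mh : measurable_fun setT h.
  apply: measurable_maxr => //; apply: measurable_funB; exact: measurable_funD.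
have wT (p : C) : weight setT p = (cone_radius p ^+ 2)%:E.
  by rewrite /weight diracT mule1.
have i1 : (\int[q]_p (cone_radius p.1 ^+ 2)%:E = mu setT)%E.
  by rewrite -qmu// Pr_pushforward//; apply: eq_integral => p _; rewrite wT.
have i2 : (\int[q]_p (cone_radius p.2 ^+ 2)%:E = nu setT)%E.
  by rewrite -qnu// Pr_pushforward//; apply: eq_integral => p _; rewrite wT.
have P0 p : 0 <= P p by exact: potential_ge0.
have Q0 p : 0 <= Q p by exact: potential_ge0.
have h0 p : 0 <= h p by rewrite /h le_max lexx.
have : (\int[q]_p (cone_radius p.1 ^+ 2 + cone_radius p.2 ^+ 2)%:E <=
    \int[q]_p (h p + (P p.1 + Q p.2))%:E)%E.
  apply: ge0_le_integral => //.
  - by move=> p _; rewrite lee_fin addr_ge0 ?sqr_ge0.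
  - by apply/measurable_EFinP; exact: measurable_funD.
  - by apply/measurable_EFinP; do 2 apply: measurable_funD => //.
  - move=> p _; rewrite lee_fin -lerBlDr /h le_max lexx orbT//.
under eq_integral do rewrite EFinD.
rewrite ge0_integralD//; first last.
- exact/measurable_EFinP.
- by move=> p _; rewrite lee_fin sqr_ge0.
- exact/measurable_EFinP.
- by move=> p _; rewrite lee_fin sqr_ge0.
rewrite i1 i2.
under [leRHS]eq_integral do rewrite EFinD.
rewrite ge0_integralD//; first last.
- by apply/measurable_EFinP; exact: measurable_funD.
- by move=> p _; rewrite lee_fin addr_ge0.
- exact/measurable_EFinP.
- by move=> p _; rewrite lee_fin.
under [X in (_ <= _ + X)%E]eq_integral do rewrite EFinD.
rewrite [X in (_ <= _ + X)%E]ge0_integralD//; first last.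
- exact/measurable_EFinP.
- by move=> p _; rewrite lee_fin.
- exact/measurable_EFinP.
- by move=> p _; rewrite lee_fin.
rewrite (integral_potential _ _ _ _ qmu)// (integral_potential _ _ _ _ qnu)//.
rewrite -[X in (X + _ <= _)%E]fineK ?fin_num_measure//.
rewrite -[X in (_ + X <= _)%E]fineK ?fin_num_measure//.
rewrite -!EFinD => H.
rewrite -addrA -opprD EFinB leeBlDr//; apply: (le_trans H); rewrite leeD2r//.
by apply: ge0_le_integral_nomeas => p; rewrite lee_fin.
Qed.

End WeakDuality.

(** * Finitely supported measures *)

Section Clouds.
Variables (R : realType) (n : nat).
Local Notation C := (cone R n).
Local Open Scope ring_scope.
Implicit Types (s t : seq (Rn R n * R)) (x y : Rn R n).

Lemma edistxx x : edist x x = 0.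
Proof. by rewrite /edist big1 ?sqrtr0// => i _; rewrite subrr expr0n. Qed.

Lemma edistC x y : edist x y = edist y x.
Proof. by congr (Num.sqrt _); apply: eq_bigr => i _; rewrite -sqrrN opprB. Qed.

(** The point of the cone with base [x] and radius [`|r|]. *)
Definition cone_pt (p : Rn R n * R) : C :=
  (\pi_(cone_quot R n) (p.1, NngNum (normr_ge0 p.2)))%qT.

Lemma cone_pt_radius p : cone_radius (cone_pt p) = `|p.2|.
Proof. exact: cone_radius_pi. Qed.

Lemma cone_dist_pt x y (r s : R) : 0 <= r -> 0 <= s ->
  cone_dist (cone_pt (x, r)) (cone_pt (y, s)) ^+ 2 =
  r ^+ 2 + s ^+ 2 - 2 * r * s * cos (Num.min (edist x y) pi).
Proof.
move=> r0 s0; rewrite cone_dist_sqr !cone_pt_radius/= !ger0_norm//.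
have [->|rN0] := eqVneq r 0; first by rewrite !(mulr0, mul0r).
have [->|sN0] := eqVneq s 0; first by rewrite !(mulr0, mul0r).
by rewrite /cone_cos !cone_base_pi//= ger0_norm.
Qed.

Lemma weight_pt A p : weight A (cone_pt p) = ((p.2 ^+ 2)%:E * \d_(p.1) A)%E.
Proof.
rewrite /weight cone_pt_radius real_normK ?num_real//.
have [->|p0] := eqVneq p.2 0; first by rewrite expr0n/= !mul0e.
by rewrite cone_base_pi//= normr_eq0.
Qed.

Lemma weight_vertex A : weight A (cone_vertex R n) = 0%E.
Proof. by rewrite /weight cone_radius_pi expr0n/= mul0e. Qed.

(** The finitely supported measure whose atoms are the points [p.1] with masses
    [p.2 ^+ 2], for [p] in [s]. *)
Definition cloud s : set (Rn R n) -> \bar R :=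
  msum (fun i => mscale (NngNum (sqr_ge0 (nth (point, 0) s i).2))
                   \d_((nth (point, 0) s i).1)) (size s).

HB.instance Definition _ s := Measure.on (cloud s).

Lemma cloudE s A : cloud s A = (\sum_(p <- s) (p.2 ^+ 2)%:E * \d_(p.1) A)%E.
Proof. by rewrite (big_nth (point, 0)) big_mkord. Qed.

Lemma cloud_EFin s A : cloud s A = (\sum_(p <- s) p.2 ^+ 2 * \1_A p.1)%:E.
Proof. by rewrite cloudE -sumEFin; apply: eq_bigr => p _; rewrite EFinM. Qed.

Let cloud_fin s : fin_num_fun (cloud s).
Proof. by move=> A _; rewrite cloud_EFin. Qed.

HB.instance Definition _ s := Measure_isFinite.Build _ _ _ (cloud s) (@cloud_fin s).

Lemma fine_cloud s A : fine (cloud s A) = \sum_(p <- s) p.2 ^+ 2 * \1_A p.1.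
Proof. by rewrite cloud_EFin. Qed.

Lemma sum_cloud1 s (f : Rn R n -> R) :
  \sum_(x <- undup (map fst s)) f x * fine (cloud s [set x]) =
  \sum_(p <- s) f p.1 * p.2 ^+ 2.
Proof.
under eq_bigr do rewrite fine_cloud mulr_sumr.
rewrite exchange_big/= !big_seq; apply: eq_bigr => p ps.
rewrite (bigD1_seq p.1)/= ?undup_uniq ?mem_undup ?map_f//.
rewrite indicE mem_set// mulr1 big1 ?addr0// => x xp.
by rewrite indicE memNset ?mulr0// => /= px; rewrite px eqxx in xp.
Qed.

(** Weak duality for finitely supported measures. *)
Lemma HK2_cloud_ge s t (f g : Rn R n -> R) :
  (forall x, 0 < f x) -> (forall y, 0 < g y) ->
  (forall p q, p \in s -> q \in t -> forall a b, 0 <= a -> 0 <= b ->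
    2 * a * b * cos (Num.min (edist p.1 q.1) pi) <= f p.1 * a ^+ 2 + g q.1 * b ^+ 2) ->
  ((\sum_(p <- s) (1 - f p.1) * p.2 ^+ 2 + \sum_(q <- t) (1 - g q.1) * q.2 ^+ 2)%:E
    <= HK2 (cloud s) (cloud t))%E.
Proof.
move=> f0 g0 fg.
have N u : cloud u (~` [set` undup (map fst u)]) = 0%E.
  rewrite cloudE big_seq big1// => p pu.
  by rewrite diracE memNset ?mule0//=; apply; rewrite mem_undup map_f.
have := @HK2_ge R n (cloud s) (cloud t) _ _ f g (undup_uniq (map fst s))
  (undup_uniq (map fst t)) (N s) (N t) f0 g0.
rewrite !sum_cloud1 !fine_cloud => H.
rewrite (_ : _ + _ = \sum_(p <- s) p.2 ^+ 2 * \1_[set: Rn R n] p.1 +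
   \sum_(p <- t) p.2 ^+ 2 * \1_[set: Rn R n] p.1 -
   \sum_(p <- s) f p.1 * p.2 ^+ 2 - \sum_(p <- t) g p.1 * p.2 ^+ 2).
  apply: H => x y a b; rewrite !mem_undup => /mapP[p ps ->] /mapP[q qt ->].
  exact: fg.
rewrite -addrA addrACA -!sumrB; congr (_ + _); apply: eq_bigr => p _.
  by rewrite indicE in_setT mulr1; ring.
by rewrite indicE in_setT mulr1; ring.
Qed.

Lemma HK2_cloud_le (s : seq ((Rn R n * R) * (Rn R n * R))) :
  (HK2 (cloud (map fst s)) (cloud (map snd s)) <=
   (\sum_(p <- s) cone_dist (cone_pt p.1) (cone_pt p.2) ^+ 2)%:E)%E.
Proof.
have := @HK2_le_plan R n (cloud (map fst s)) (cloud (map snd s))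
  [seq (cone_pt p.1, cone_pt p.2) | p <- s].
rewrite big_map/=; apply => A mA; rewrite cloudE !big_map;
  by apply: eq_bigr => p _; rewrite weight_pt.
Qed.

(** All the mass may be destroyed and created again. *)
Lemma HK2_cloud_le_mass s t :
  (HK2 (cloud s) (cloud t) <=
   (\sum_(p <- s) p.2 ^+ 2 + \sum_(p <- t) p.2 ^+ 2)%:E)%E.
Proof.
have := @HK2_le_plan R n (cloud s) (cloud t)
  ([seq (cone_pt p, cone_vertex R n) | p <- s] ++
   [seq (cone_vertex R n, cone_pt p) | p <- t]).
have V p : cone_dist (cone_vertex R n) (cone_pt p) ^+ 2 = p.2 ^+ 2.
  rewrite cone_dist_sqr cone_pt_radius {1 2}/cone_vertex !cone_radius_pi.
  by rewrite /= real_normK ?num_real//; ring.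
have V' p : cone_dist (cone_pt p) (cone_vertex R n) ^+ 2 = p.2 ^+ 2.
  rewrite cone_dist_sqr cone_pt_radius {1 2}/cone_vertex !cone_radius_pi.
  by rewrite /= real_normK ?num_real//; ring.
rewrite big_cat !big_map/=.
under eq_bigr do rewrite V'.
under [X in (_ + X)%:E]eq_bigr do rewrite V.
apply => A mA; rewrite cloudE big_cat !big_map/=.
  rewrite [X in (_ + X)%E]big1 ?adde0 => [|p _]; last exact: weight_vertex.
  by apply: eq_bigr => p _; rewrite weight_pt.
rewrite [X in (X + _)%E]big1 ?add0e => [|p _]; last exact: weight_vertex.
by apply: eq_bigr => p _; rewrite weight_pt.
Qed.

Lemma HK2_fin s t : HK2 (cloud s) (cloud t) \is a fin_num.
Proof.
rewrite ge0_fin_numE ?HK2_ge0//; apply: le_lt_trans (HK2_cloud_le_mass s t) _.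
exact: ltry.
Qed.

(** The empty sequence gives the zero measure. *)
Lemma HK_nil_le s : HK (cloud [::]) (cloud s) <= Num.sqrt (\sum_(p <- s) p.2 ^+ 2).
Proof.
rewrite HKE ler_sqrt; last by apply: sumr_ge0 => p _; exact: sqr_ge0.
rewrite -lee_fin fineK ?HK2_fin//; apply: le_trans (HK2_cloud_le_mass _ _) _.
by rewrite big_nil add0r.
Qed.

Lemma HK_cloud_eq s t (v : R) : (HK2 (cloud s) (cloud t) <= v%:E)%E ->
  (forall e : R, 0 < e -> ((v - e)%:E <= HK2 (cloud s) (cloud t))%E) ->
  HK (cloud s) (cloud t) = Num.sqrt v.
Proof.
rewrite HKE -(fineK (HK2_fin s t)) lee_fin => le ge; congr Num.sqrt.
apply/eqP; rewrite eq_le le/=; apply/ler_addgt0Pr => e e0.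
by rewrite -lerBlDr -lee_fin; exact: ge.
Qed.

(** Optimal weights for the arithmetic-geometric inequality, up to an error
    that accounts for the vanishing of [a] or [b]. *)
Lemma weighted_AGM (a b e : R) : 0 <= a -> 0 <= b -> 0 < e ->
  exists2 c : R, 0 < c & c * a ^+ 2 + c^-1 * b ^+ 2 <= 2 * a * b + e.
Proof.
move=> a0 b0 e0.
pose h := e / (a + b + 1).
have ab : 0 < a + b + 1 by lra.
have h0 : 0 < h by rewrite divr_gt0.
have he : h * (a + b) <= e.
  rewrite /h mulrAC ler_pdivrMr//; nra.
have ah : 0 < a + h by lra.
have bh : 0 < b + h by lra.
exists ((b + h) / (a + h)); first by rewrite divr_gt0.
have -> : (b + h) / (a + h) * a ^+ 2 = (b + h) * a * (a / (a + h)) by field; lra.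
have -> : ((b + h) / (a + h))^-1 * b ^+ 2 = (a + h) * b * (b / (b + h)) by field; lra.
have A1 : (b + h) * a * (a / (a + h)) <= (b + h) * a.
  rewrite ler_piMr//; first by rewrite mulr_ge0// ltW.
  by rewrite ler_pdivrMr//; lra.
have A2 : (a + h) * b * (b / (b + h)) <= (a + h) * b.
  rewrite ler_piMr//; first by rewrite mulr_ge0// ltW.
  by rewrite ler_pdivrMr//; lra.
nra.
Qed.

Lemma weighted_AGM_le (c a b k : R) : 0 < c -> 0 <= a -> 0 <= b -> k <= 1 ->
  2 * a * b * k <= c * a ^+ 2 + c^-1 * b ^+ 2.
Proof.
move=> c0 a0 b0 k1.
apply: (@le_trans _ _ (2 * a * b)); first by rewrite ler_piMr// !mulr_ge0.
rewrite -(ler_pM2l c0) mulrDr mulVKf ?gt_eqF//.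
by have := sqr_ge0 (c * a - b); nra.
Qed.

(** Between two atoms at distance at most [pi / 2], [HK] is the distance of the
    cone. *)
Lemma HK_atom x y (r s : R) : 0 <= r -> 0 <= s -> edist x y <= pi / 2 ->
  HK (cloud [:: (x, r)]) (cloud [:: (y, s)]) =
  Num.sqrt (r ^+ 2 + s ^+ 2 - 2 * r * s * cos (edist x y)).
Proof.
move=> r0 s0 xy; have pi0 := @pi_gt0 R.
have exy := edist_ge0 x y.
have mE : Num.min (edist x y) pi = edist x y by apply/min_idPl; lra.
apply: HK_cloud_eq.
  have := HK2_cloud_le [:: ((x, r), (y, s))].
  by rewrite big_seq1 cone_dist_pt// mE.
move=> e e0.
have c0 : 0 <= cos (edist x y) by rewrite cos_ge0_pihalf// xy andbT; lra.
have c1 : cos (edist x y) <= 1 by exact: cos_le1.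
set c := cos (edist x y) in c0 c1 *.
have rs0 : 0 <= r * s by exact: mulr_ge0.
(* The cosine may vanish, so it is replaced by [c + h] to keep the potentials
   positive; [h] is such that the loss [2 * r * s * h] is at most [e / 2]. *)
pose h := Num.min 1 (e / (4 * (r * s + 1))).
have h0 : 0 < h by rewrite lt_min ltr01 divr_gt0//; lra.
have h1 : h <= 1 by rewrite ge_min lexx.
have he : h * (4 * (r * s + 1)) <= e by rewrite -ler_pdivlMr ?ge_min ?lexx ?orbT//; lra.
have e4 : 0 < e / 4 by lra.
have [k k0 kle] := weighted_AGM r0 s0 e4.
have ch0 : 0 < c + h by lra.
have := @HK2_cloud_ge [:: (x, r)] [:: (y, s)]
  (fun=> (c + h) * k) (fun=> (c + h) * k^-1).
rewrite !big_seq1/= => H; apply: le_trans (H _ _ _); clear H.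
- rewrite lee_fin.
  have : (c + h) * (k * r ^+ 2 + k^-1 * s ^+ 2) <= (c + h) * (2 * r * s + e / 4).
    by rewrite ler_pM2l.
  have : (c + h) * (e / 4) <= 2 * (e / 4) by rewrite ler_pM2r//; lra.
  nra.
- by move=> _; rewrite mulr_gt0.
- by move=> _; rewrite mulr_gt0// invr_gt0.
move=> p q; rewrite !inE => /eqP-> /eqP-> a b a0 b0 /=; rewrite mE -/c.
rewrite -!mulrA -mulrDr.
have := @weighted_AGM_le k a b 1 k0 a0 b0 (lexx _); rewrite mulr1 => K.
apply: (@le_trans _ _ ((c + h) * (2 * a * b))).
  by have := mulr_ge0 a0 b0; nra.
by rewrite ler_pM2l.
Qed.

(** Between measures carried by two points at distance [pi / 2] from each other,
    [HK] is the Euclidean distance of the square roots of the masses: transport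
    from one point to the other is not cheaper than destruction and creation. *)
Lemma HK_two_atoms x y (a b a' b' : R) : edist x y = pi / 2 ->
  0 <= a -> 0 <= b -> 0 <= a' -> 0 <= b' ->
  HK (cloud [:: (x, a); (y, b)]) (cloud [:: (x, a'); (y, b')]) =
  Num.sqrt ((a - a') ^+ 2 + (b - b') ^+ 2).
Proof.
move=> xy a0 b0 a'0 b'0; have pi0 := @pi_gt0 R.
have mE : Num.min (edist x y) pi = pi / 2 by rewrite xy; apply/min_idPl; lra.
have m0 (z : Rn R n) : Num.min (edist z z) pi = 0 by rewrite edistxx; apply/min_idPl; lra.
have yx : y != x.
  by apply/eqP => yx; move: xy; rewrite yx edistxx; lra.
apply: HK_cloud_eq.
  have := HK2_cloud_le [:: ((x, a), (x, a')); ((y, b), (y, b'))].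
  rewrite big_cons big_seq1/= !cone_dist_pt// !m0 cos0 !mulr1.
  by congr (_ <= _%:E)%E; ring.
move=> e e0; have e2 : 0 < e / 2 by lra.
have [k k0 kle] := weighted_AGM a0 a'0 e2.
have [l l0 lle] := weighted_AGM b0 b'0 e2.
have := @HK2_cloud_ge [:: (x, a); (y, b)] [:: (x, a'); (y, b')]
  (fun z => if z == x then k else l) (fun z => if z == x then k^-1 else l^-1).
rewrite !big_cons !big_nil/= eqxx (negbTE yx) => H; apply: le_trans (H _ _ _); clear H.
- by rewrite lee_fin; lra.
- by move=> z; case: ifP.
- by move=> z; case: ifP; rewrite invr_gt0.
have A (c u v : R) : 0 < c -> 0 <= u -> 0 <= v ->
   2 * u * v * cos 0 <= c * u ^+ 2 + c^-1 * v ^+ 2.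
  by move=> c0 u0 v0; apply: weighted_AGM_le => //; rewrite cos0.
have B (c d u v : R) : 0 < c -> 0 < d -> 0 <= u -> 0 <= v ->
   2 * u * v * cos (pi / 2) <= c * u ^+ 2 + d^-1 * v ^+ 2.
  move=> c0 d0 u0 v0; rewrite cos_pihalf mulr0.
  by rewrite addr_ge0// mulr_ge0 ?sqr_ge0 ?invr_ge0// ltW.
move=> p q; rewrite !inE => /orP[]/eqP-> /orP[]/eqP-> u v u0 v0 /=;
  rewrite ?eqxx ?(negbTE yx) ?m0 ?mE; [exact: A|exact: B| |exact: A].
by rewrite edistC mE; exact: B.
Qed.

End Clouds.

(** * Shortest paths of atoms *)

Section Paths.
Variables (R : realType) (n : nat).
Local Notation M0 := {finite_measure set (Rn R n) -> \bar R}.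
Local Notation hk := (@HK R n).
Implicit Types (x y : 'rV[R]_n).

Lemma eq_finite_measure (m1 m2 : M0) : m1 = m2 :> (set _ -> \bar R) -> m1 = m2.
Proof.
destruct m1 as [m1 [[a1 a2] [b1] [c1] [d1] [e1]]].
destruct m2 as [m2 [[a1' a2'] [b1'] [c1'] [d1'] [e1']]].
move=> /= m12; subst m2.
have ? := Prop_irrelevance a1' a1; have ? := Prop_irrelevance a2' a2.
subst a1' a2'.
have ? := Prop_irrelevance b1' b1; have ? := Prop_irrelevance c1' c1.
have ? := Prop_irrelevance d1' d1; have ? := Prop_irrelevance e1' e1.
by subst b1' c1' d1' e1'.
Qed.

Lemma shortest_path_isometric (X : Type) (d : X -> X -> R) (g : R -> X) (L : R) :
  (forall s t, 0 <= s <= 1 -> 0 <= t <= 1 -> d (g s) (g t) = `|s - t| * L) ->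
  shortest_path d (g 0) (g 1) g /\ d (g 0) (g 1) = L.
Proof.
move=> H; have E : d (g 0) (g 1) = L.
  by rewrite H ?lexx ?ler01// sub0r normrN1 mul1r.
by split=> //; split=> // s t s01 t01; rewrite E; exact: H.
Qed.

Lemma half01 : 0 <= (1 / 2 : R) <= 1.
Proof. by apply/andP; split; lra. Qed.

Lemma shortest_path_mid (X : Type) (d : X -> X -> R) (a b : X) (g : R -> X) (L : R) :
  shortest_path d a b g -> d a b = 2 * L ->
  d a (g (1 / 2)) = L /\ d (g (1 / 2)) b = L.
Proof.
move=> [ga gb gd] ab; split.
  rewrite -[X in d X _]ga gd ?half01 ?lexx ?ler01// ab sub0r normrN ger0_norm; lra.
rewrite -[X in d _ X]gb gd ?half01 ?lexx ?ler01// ab ler0_norm; lra.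
Qed.

(** The polar angle of a point of the closed quadrant other than the origin. *)
Definition angle (u v : R) : R := acos (u / Num.sqrt (u ^+ 2 + v ^+ 2)).

Section Angle.
Variables u v : R.
Hypotheses (u0 : 0 <= u) (v0 : 0 <= v) (uv : 0 < u ^+ 2 + v ^+ 2).
Let rho := Num.sqrt (u ^+ 2 + v ^+ 2).

Let rho_gt0 : 0 < rho. Proof. by rewrite sqrtr_gt0. Qed.

Let rho2 : rho ^+ 2 = u ^+ 2 + v ^+ 2. Proof. by rewrite sqr_sqrtr// ltW. Qed.

Let ratio01 : 0 <= u / rho <= 1.
Proof.
rewrite divr_ge0 ?(ltW rho_gt0)//= ler_pdivrMr// mul1r.
rewrite -(@ler_sqr _ u) ?nnegrE ?(ltW rho_gt0)// rho2 lerDl sqr_ge0//.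
Qed.

Let ratioN11 : -1 <= u / rho <= 1.
Proof. by case/andP: ratio01 => h ->; rewrite (le_trans _ h)// lerN10. Qed.

Lemma cos_angle : cos (angle u v) = u / rho.
Proof. by rewrite acosK// in_itv. Qed.

Lemma sin_angle : sin (angle u v) = v / rho.
Proof.
rewrite sin_acos// -[RHS]ger0_norm ?divr_ge0 ?(ltW rho_gt0)// -sqrtr_sqr.
congr Num.sqrt; rewrite !expr_div_n rho2.
by field; rewrite gt_eqF.
Qed.

Lemma angle_ge0 : 0 <= angle u v. Proof. exact: acos_ge0. Qed.

Lemma angle_le : angle u v <= pi / 2.
Proof.
have pi0 := @pi_gt0 R.
rewrite -(@ler_cos R) ?in_itv/= ?angle_ge0 ?acos_lepi//; last by lra.
by rewrite cos_pihalf cos_angle; case/andP: ratio01.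
Qed.

End Angle.

(** The atom of mass [u ^+ 2 + v ^+ 2] on the line through [x] and [y] whose
    distance to [x] is the polar angle of [(u, v)]: this embeds the quadrant
    isometrically. *)
Definition sector x y (u v : R) : M0 :=
  cloud [:: ((x + (angle u v / edist (x : Rn R n) (y : Rn R n)) *: (y - x) : Rn R n),
             Num.sqrt (u ^+ 2 + v ^+ 2))].

Lemma HK_sector x y (u v u' v' : R) :
  0 < edist (x : Rn R n) (y : Rn R n) ->
  0 <= u -> 0 <= v -> 0 < u ^+ 2 + v ^+ 2 ->
  0 <= u' -> 0 <= v' -> 0 < u' ^+ 2 + v' ^+ 2 ->
  hk (sector x y u v) (sector x y u' v') = Num.sqrt ((u - u') ^+ 2 + (v - v') ^+ 2).
Proof.
move=> xy0 u0 v0 uv u'0 v'0 uv'.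
have E : edist
   (x + (angle u v / edist (x : Rn R n) (y : Rn R n)) *: (y - x) : Rn R n)
   (x + (angle u' v' / edist (x : Rn R n) (y : Rn R n)) *: (y - x) : Rn R n)
   = `|angle u v - angle u' v'|.
  rewrite edist_line -mulrBl normrM normfV (gtr0_norm xy0).
  by rewrite divfK// gt_eqF.
rewrite /sector HK_atom ?sqrtr_ge0// E.
  rewrite cos_norm cosB !cos_angle// !sin_angle//.
  rewrite !sqr_sqrtr ?(ltW uv) ?(ltW uv')//; congr Num.sqrt.
  have r0 : Num.sqrt (u ^+ 2 + v ^+ 2) != 0 by rewrite gt_eqF ?sqrtr_gt0.
  have r'0 : Num.sqrt (u' ^+ 2 + v' ^+ 2) != 0 by rewrite gt_eqF ?sqrtr_gt0.
  by move: r0 r'0; move: (Num.sqrt _) (Num.sqrt _) => r r' r0 r'0; field; rewrite r0 r'0.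
have := angle_le u0 uv; have := angle_le u'0 uv'.
have := angle_ge0 u0 uv; have := angle_ge0 u'0 uv'.
by rewrite ler_norml; lra.
Qed.

(** The geodesic of the cone between [(x, r)] and [(y, s)], read as a path of
    atoms: the image under [sector] of the segment from [(r, 0)] to
    [(s * cos d, s * sin d)] with [d] the distance of [x] and [y]. *)
Definition atom_path x y (r s t : R) : M0 :=
  sector x y ((1 - t) * r + t * (s * cos (edist (x : Rn R n) (y : Rn R n))))
             (t * (s * sin (edist (x : Rn R n) (y : Rn R n)))).

Section AtomPath.
Variables (x y : 'rV[R]_n) (r s : R).
Hypotheses (r0 : 0 < r) (s0 : 0 < s).
Let theta := edist (x : Rn R n) (y : Rn R n).
Hypotheses (xy0 : 0 < theta) (xy1 : theta <= pi / 2).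

Let c0 : 0 <= cos theta.
Proof. by apply: cos_ge0_pihalf; rewrite xy1 andbT; move: (ltW xy0) (@pi_gt0 R); lra. Qed.

Let s0' : 0 < sin theta.
Proof. by apply: sin_gt0_pi; rewrite xy0 /=; move: xy1 (@pi_gt0 R); lra. Qed.

Let U t := (1 - t) * r + t * (s * cos theta).
Let V t := t * (s * sin theta).

Let U0 t : 0 <= t <= 1 -> 0 <= U t.
Proof.
move=> /andP[t0 t1]; rewrite addr_ge0// mulr_ge0 ?subr_ge0 ?(ltW r0)//.
by rewrite mulr_ge0// ltW.
Qed.

Let V0 t : 0 <= t <= 1 -> 0 <= V t.
Proof. by move=> /andP[t0 t1]; rewrite mulr_ge0// mulr_ge0 ?ltW. Qed.

Let UV0 t : 0 <= t <= 1 -> 0 < U t ^+ 2 + V t ^+ 2.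
Proof.
move=> /andP[]; rewrite le_eqVlt => /predU1P[<- _|t0 t1].
  by rewrite /U /V subr0 !mul0r mul1r addr0 expr0n/= addr0 exprn_gt0.
by rewrite ltr_wpDl ?sqr_ge0// exprn_gt0// !mulr_gt0.
Qed.

Lemma HK_atom_path t1 t2 : 0 <= t1 <= 1 -> 0 <= t2 <= 1 ->
  hk (atom_path x y r s t1) (atom_path x y r s t2) =
  `|t1 - t2| * Num.sqrt (r ^+ 2 + s ^+ 2 - 2 * r * s * cos theta).
Proof.
move=> t101 t201; rewrite /atom_path HK_sector -/theta ?U0 ?V0 ?UV0//.
rewrite -sqrtr_sqr -sqrtrM ?sqr_ge0//; congr Num.sqrt.
have cs := cos2Dsin2 theta; rewrite /U /V.
transitivity ((t1 - t2) ^+ 2 * ((s * cos theta - r) ^+ 2 + s ^+ 2 * sin theta ^+ 2)).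
  by ring.
by rewrite sin2cos2; ring.
Qed.

Lemma atom_path0 : atom_path x y r s 0 = cloud [:: (x : Rn R n, r)].
Proof.
rewrite /atom_path /sector /angle subr0 !mul0r mul1r addr0 expr0n/= addr0.
rewrite sqrtr_sqr gtr0_norm// divff ?gt_eqF// acos1 mul0r scale0r addr0 //.
Qed.

Lemma atom_path1 : atom_path x y r s 1 = cloud [:: (y : Rn R n, s)].
Proof.
rewrite /atom_path /sector /angle -/theta subrr mul0r !mul1r add0r.
have -> : (s * cos theta) ^+ 2 + (s * sin theta) ^+ 2 = s ^+ 2.
  by rewrite !exprMn -mulrDr cos2Dsin2 mulr1.
rewrite sqrtr_sqr gtr0_norm// [s * cos theta]mulrC mulfK ?gt_eqF// cosK.
  by rewrite divff ?gt_eqF// scale1r addrC subrK.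
by rewrite in_itv/= ltW//=; move: xy1 (@pi_gt0 R); lra.
Qed.

Lemma HK_nil_atom_path t : 0 <= t <= 1 ->
  hk (cloud [::]) (atom_path x y r s t) <= r + s.
Proof.
move=> t01; apply: le_trans (HK_nil_le _) _.
rewrite big_seq1 /= sqrtr_sqr ger0_norm ?sqrtr_ge0// -/theta.
have rs0 : 0 <= r + s by rewrite addr_ge0 ?ltW.
rewrite -(@ger0_norm _ (r + s))// -sqrtr_sqr ler_sqrt ?sqr_ge0//.
have -> : ((1 - t) * r + t * (s * cos theta)) ^+ 2 + (t * (s * sin theta)) ^+ 2 =
    ((1 - t) * r) ^+ 2 + (t * s) ^+ 2 * (cos theta ^+ 2 + sin theta ^+ 2)
    + 2 * ((1 - t) * r) * (t * s) * cos theta by ring.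
rewrite cos2Dsin2 mulr1.
case/andP: t01 => t0 t1.
have A0 : 0 <= (1 - t) * r by rewrite mulr_ge0 ?subr_ge0// ltW.
have B0 : 0 <= t * s by rewrite mulr_ge0// ltW.
have AB : (1 - t) * r + t * s <= r + s.
  by rewrite lerD// ler_piMl ?(ltW r0) ?(ltW s0)//; lra.
have C : 2 * ((1 - t) * r) * (t * s) * cos theta <= 2 * ((1 - t) * r) * (t * s).
  by rewrite ler_piMr ?cos_le1// mulr_ge0// mulr_ge0.
apply: (@le_trans _ _ (((1 - t) * r + t * s) ^+ 2)).
  by move: C; rewrite sqrrD mulr2n; lra.
by rewrite ler_sqr// nnegrE// addr_ge0.
Qed.

Lemma shortest_atom_path :
  shortest_path hk (cloud [:: (x : Rn R n, r)]) (cloud [:: (y : Rn R n, s)])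
    (atom_path x y r s)
  /\ hk (cloud [:: (x : Rn R n, r)]) (cloud [:: (y : Rn R n, s)]) =
     Num.sqrt (r ^+ 2 + s ^+ 2 - 2 * r * s * cos theta).
Proof.
by rewrite -atom_path0 -atom_path1; apply: shortest_path_isometric; exact: HK_atom_path.
Qed.

End AtomPath.

End Paths.

(** * Bounds for trigonometric and hyperbolic functions *)

Section Trigonometry.
Variable R : realType.
Implicit Types x y : R.

Lemma sin_bounds x : 0 <= x <= pi -> x * cos x <= sin x <= x.
Proof.
move=> /andP[]; rewrite le_eqVlt => /predU1P[<- _|x0 xpi].
  by rewrite sin0 mul0r lexx.
have [c] := @MVT R sin cos 0 x x0 (fun c _ => is_derive_sin c)
  (continuous_subspaceT (@continuous_sin R)).
rewrite in_itv/= => /andP[c0 cx]; rewrite sin0 !subr0 => ->.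
rewrite [x * _]mulrC !ler_pM2r// ler_piMl ?cos_le1 ?(ltW x0)// andbT.
by rewrite ler_cos ?ltW// in_itv/= ?(ltW x0)// (ltW c0)/= (le_trans (ltW cx)).
Qed.

Lemma cos_half x : cos x = 1 - 2 * sin (x / 2) ^+ 2.
Proof.
have {1}-> : x = (x / 2) *+ 2 by rewrite mulr2n; lra.
by rewrite cos_mulr2n cos2sin2 mulr2n; ring.
Qed.

Lemma cos_ge_quadratic x : 0 <= x <= 2 -> 1 - x ^+ 2 / 2 <= cos x.
Proof.
move=> /andP[x0 x2]; rewrite cos_half.
have p2 := @pi_ge2 R.
have /sin_bounds/andP[_ s] : 0 <= x / 2 <= pi by apply/andP; split; lra.
have s0 : 0 <= sin (x / 2) by rewrite sin_ge0_pi//; apply/andP; split; lra.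
have : sin (x / 2) ^+ 2 <= (x / 2) ^+ 2 by rewrite ler_sqr// nnegrE; lra.
by rewrite expr_div_n; lra.
Qed.

Lemma cos_le_quartic x : 0 <= x <= 2 -> cos x <= 1 - x ^+ 2 / 2 + x ^+ 4 / 8.
Proof.
move=> /andP[x0 x2]; rewrite cos_half.
have p2 := @pi_ge2 R.
have /sin_bounds/andP[s _] : 0 <= x / 2 <= pi by apply/andP; split; lra.
have /cos_ge_quadratic c : 0 <= x / 2 <= 2 by apply/andP; split; lra.
have -> : x ^+ 4 = 16 * ((x / 2) ^+ 2) ^+ 2 by field.
have -> : x ^+ 2 = 4 * (x / 2) ^+ 2 by field.
have y0 : 0 <= x / 2 by lra.
have y1 : x / 2 <= 1 by lra.
move: (x / 2) y0 y1 c s => y y0 y1 c s.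
have y21 : y ^+ 2 <= 1 by rewrite expr_le1.
have A : y * (1 - y ^+ 2 / 2) <= sin y by apply: le_trans s; rewrite ler_wpM2l.
have B : 0 <= y * (1 - y ^+ 2 / 2) by rewrite mulr_ge0//; lra.
have : (y * (1 - y ^+ 2 / 2)) ^+ 2 <= sin y ^+ 2 by rewrite ler_sqr ?nnegrE// (le_trans B).
rewrite exprMn; set z := y ^+ 2; set S := sin y ^+ 2.
have z0 : 0 <= z by exact: sqr_ge0.
have : 0 <= z * z ^+ 2 by rewrite mulr_ge0 ?sqr_ge0.
by rewrite -/z; nra.
Qed.

(** [cos (pi / 3)] is the non-negative root of [(c + 1) * (2 * c - 1) ^+ 2], the
    triplication formula for [pi]. *)
Lemma cos_pi3 : cos (pi / 3) = 1 / 2 :> R.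
Proof.
have p0 := @pi_gt0 R.
set c := cos (pi / 3).
have c0 : 0 <= c by rewrite cos_ge0_pihalf//; apply/andP; split; lra.
have : cos (pi / 3 + (pi / 3 + pi / 3)) = -1 :> R.
  by rewrite -cospi; congr cos; lra.
rewrite cosD cosD sinD -/c.
have s2 : sin (pi / 3) ^+ 2 = 1 - c ^+ 2 by exact: sin2cos2.
move=> E; have E2 : c * (c ^+ 2 - sin (pi / 3) ^+ 2) - 2 * c * sin (pi / 3) ^+ 2 = -1.
  by rewrite -E; ring.
have : (c + 1) * (2 * c - 1) ^+ 2 = 0 by rewrite s2 in E2; lra.
by move/eqP; rewrite mulf_eq0 sqrf_eq0 => /orP[]/eqP; lra.
Qed.

(** Hyperbolic cosine and sine. *)
Definition cosh x := (expR x + expR (- x)) / 2.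
Definition sinh x := (expR x - expR (- x)) / 2.

Lemma expRM1 x : expR x * expR (- x) = 1.
Proof. by rewrite -expRD subrr expR0. Qed.

Lemma cosh2sinh2 x : cosh x ^+ 2 - sinh x ^+ 2 = 1.
Proof. by rewrite -(expRM1 x) /cosh /sinh; field. Qed.

Lemma cosh_half x : cosh x = 1 + 2 * sinh (x / 2) ^+ 2.
Proof.
rewrite /cosh /sinh.
have -> : expR x = expR (x / 2) ^+ 2 by rewrite expr2 -expRD; congr expR; lra.
have -> : expR (- x) = expR (- (x / 2)) ^+ 2.
  by rewrite expr2 -expRD; congr expR; lra.
by rewrite -[X in _ = X + _](expRM1 (x / 2)); field.
Qed.

Lemma cosh2 x : cosh (2 * x) = cosh x ^+ 2 + sinh x ^+ 2.
Proof.
by rewrite cosh_half [2 * x]mulrC mulfK ?pnatr_eq0// -[X in X + _](cosh2sinh2 x); ring.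
Qed.

Lemma cosh_ge1 x : 1 <= cosh x.
Proof. by rewrite cosh_half lerDl mulr_ge0// sqr_ge0. Qed.

Lemma cosh0 : cosh 0 = 1.
Proof. by rewrite /cosh oppr0 expR0; lra. Qed.

Lemma sinh_ge0 x : 0 <= x -> 0 <= sinh x.
Proof.
by move=> x0; rewrite /sinh divr_ge0// subr_ge0 ler_expR; lra.
Qed.

Lemma sinh_bounds x : 0 <= x < 1 -> x * (1 - x) <= sinh x <= x / (1 - x).
Proof.
move=> /andP[x0 x1].
have a := expR_ge1Dx x; have b := expR_ge1Dx (- x).
have E := expRM1 x; have e0 := expR_gt0 x; have f0 := expR_gt0 (- x).
rewrite /sinh; move: (expR x) (expR (- x)) a b E e0 f0 => e f a b E e0 f0.
have f1 : f * (1 + x) <= 1 by rewrite -[leRHS]E mulrC ler_pM2r.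
have e1 : e * (1 - x) <= 1 by rewrite -[leRHS]E ler_pM2l.
apply/andP; split; last by rewrite ler_pdivlMr; nra.
rewrite -(@ler_pM2r _ (1 + x)); last lra.
have : 0 <= x * x * x by rewrite !mulr_ge0.
nra.
Qed.

Lemma cosh_bounds x : 0 <= x < 2 ->
  1 + x ^+ 2 / 2 * (1 - x / 2) ^+ 2 <= cosh x <= 1 + x ^+ 2 / 2 / (1 - x / 2) ^+ 2.
Proof.
move=> /andP[x0 x2]; rewrite cosh_half.
have /sinh_bounds/andP[l u] : 0 <= x / 2 < 1 by apply/andP; split; lra.
have -> : x ^+ 2 / 2 = 2 * (x / 2) ^+ 2 by field.
have y0 : 0 <= x / 2 by lra.
have y1 : x / 2 < 1 by lra.
move: (x / 2) y0 y1 l u => y y0 y1 l u.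
have s0 := sinh_ge0 y0.
have d0 : 0 < 1 - y by lra.
have -> : 2 * y ^+ 2 * (1 - y) ^+ 2 = 2 * (y * (1 - y)) ^+ 2 by ring.
have -> : 2 * y ^+ 2 / (1 - y) ^+ 2 = 2 * (y / (1 - y)) ^+ 2.
  by field; rewrite gt_eqF.
rewrite !lerD2l !ler_pM2l// !ler_sqr ?nnegrE//.
- by rewrite l u.
- by rewrite divr_ge0// ltW.
- by rewrite mulr_ge0// ltW.
Qed.

Lemma arcosh_cosh x : 0 <= x -> arcosh (cosh x) = x.
Proof.
move=> x0; rewrite /arcosh.
have -> : cosh x ^+ 2 - 1 = sinh x ^+ 2 by have := cosh2sinh2 x; lra.
rewrite sqrtr_sqr ger0_norm ?sinh_ge0// -[RHS]expRK; congr ln.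
by rewrite /sinh /cosh; lra.
Qed.

Lemma arcosh_gt x y : 0 <= x -> cosh x < y -> x < arcosh y.
Proof.
move=> x0 xy; rewrite -{1}(arcosh_cosh x0) /arcosh.
have c1 := cosh_ge1 x.
have S t : 0 <= Num.sqrt t :> R by exact: sqrtr_ge0.
rewrite ltr_ln ?posrE; last 2 first.
- by rewrite ltr_wpDr//; lra.
- by rewrite ltr_wpDr//; lra.
by rewrite ltr_leD// ler_wsqrtr// lerD2r ler_sqr ?nnegrE; lra.
Qed.

End Trigonometry.

(** * Isosceles triangles in the model surfaces *)

Section ModelTriangles.
Variable R : realType.
Implicit Types k h l : R.

(** A point of the space that contains the model surfaces, by coordinates. *)
Definition vec3 (a b c : R) : 'rV[R]_3 := \row_i [:: a; b; c]`_i.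

Lemma euclid3_vec3 (a b c a' b' c' : R) :
  euclid3 (vec3 a b c) (vec3 a' b' c') = a * a' + b * b' + c * c'.
Proof. by rewrite /euclid3 !mxE. Qed.

Lemma lorentz3_vec3 (a b c a' b' c' : R) :
  lorentz3 (vec3 a b c) (vec3 a' b' c') = a * a' + b * b' - c * c'.
Proof. by rewrite /lorentz3 !mxE. Qed.

Lemma vec3_2 (a b c : R) : vec3 a b c 0 2%:R = c.
Proof. by rewrite mxE. Qed.

(** The height, in the model surface of curvature [k], of an isosceles triangle
    with legs [h] and basis [2 * l], given by the theorem of Pythagoras. *)
Definition model_height k h l : R :=
  if 0 < k then acos (cos (Num.sqrt k * h) / cos (Num.sqrt k * l)) / Num.sqrt k
  else if k < 0 then
    arcosh (cosh (Num.sqrt (- k) * h) / cosh (Num.sqrt (- k) * l)) / Num.sqrt (- k)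
  else Num.sqrt (h ^+ 2 - l ^+ 2).

(** The triangle is symmetric with respect to the plane of vanishing first
    coordinate; the midpoint [D] of its basis [AC] is the pole [(0, 0, 1 / q)] of
    the surface, with [q] the square root of the absolute value of [k], or the
    origin when [k] is zero. *)
Lemma isosceles_triangle k h l : 0 <= l <= h ->
  (0 < k -> Num.sqrt k * h < pi / 2) ->
  exists A B C D : 'rV[R]_3,
    [/\ [/\ model_surface k A, model_surface k B, model_surface k C &
            model_surface k D],
        [/\ model_dist k A B = h, model_dist k B C = h & model_dist k A C = 2 * l],
        model_dist k A D = l /\ model_dist k D C = l &
        model_dist k B D = model_height k h l].
Proof.
move=> /andP[l0 lh] hk; have h0 : 0 <= h by exact: le_trans lh.
have p0 := @pi_gt0 R.
have [k0|k0|k0] := ltgtP 0 k.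
- set q := Num.sqrt k; have q0 : 0 < q by rewrite sqrtr_gt0.
  have kE : k = q ^+ 2 by rewrite sqr_sqrtr// ltW.
  have qh := hk k0; rewrite -/q in qh.
  have qlh : q * l <= q * h by rewrite ler_pM2l.
  have ql0 : 0 <= q * l by rewrite mulr_ge0// ltW.
  have cl0 : 0 < cos (q * l) by rewrite cos_gt0_pihalf//; apply/andP; split; lra.
  have ch0 : 0 < cos (q * h) by rewrite cos_gt0_pihalf//; apply/andP; split; lra.
  have clh : cos (q * h) <= cos (q * l).
    by rewrite ler_cos// in_itv/=; apply/andP; split; lra.
  set Y := cos (q * h) / cos (q * l).
  have Y0 : 0 <= Y by rewrite divr_ge0 ?ltW.
  have Y1 : Y <= 1 by rewrite ler_pdivrMr ?mul1r.
  have YE : cos (q * l) * Y = cos (q * h) by rewrite mulrC divfK ?gt_eqF.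
  have Y2 : Num.sqrt (1 - Y ^+ 2) ^+ 2 = 1 - Y ^+ 2.
    by rewrite sqr_sqrtr// subr_ge0 expr_le1.
  have sl := sin2cos2 (q * l).
  have ach : acos (cos (q * h)) = q * h by rewrite cosK// in_itv/=; apply/andP; split; lra.
  have acl : acos (cos (q * l)) = q * l by rewrite cosK// in_itv/=; apply/andP; split; lra.
  have ac2 : acos (cos (q * (2 * l))) = q * (2 * l).
    by rewrite cosK// in_itv/=; apply/andP; split; lra.
  exists (vec3 (- sin (q * l) / q) 0 (cos (q * l) / q)),
         (vec3 0 (Num.sqrt (1 - Y ^+ 2) / q) (Y / q)),
         (vec3 (sin (q * l) / q) 0 (cos (q * l) / q)), (vec3 0 0 q^-1).
  have qN0 : q != 0 by rewrite gt_eqF.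
  split.
  + split; rewrite /model_surface/= k0 euclid3_vec3 kE;
      apply: (mulfI (expf_neq0 2 qN0)); rewrite divff ?expf_neq0//.
    * by transitivity (sin (q * l) ^+ 2 + cos (q * l) ^+ 2); [field|rewrite sl; ring].
    * by transitivity (Num.sqrt (1 - Y ^+ 2) ^+ 2 + Y ^+ 2); [field|rewrite Y2; ring].
    * by transitivity (sin (q * l) ^+ 2 + cos (q * l) ^+ 2); [field|rewrite sl; ring].
    * by field.
  + rewrite /model_dist k0 -/q !euclid3_vec3 kE; split.
    * rewrite [X in acos X](_ : _ = cos (q * l) * Y); last by field.
      by rewrite YE ach mulrC mulKf.
    * rewrite [X in acos X](_ : _ = cos (q * l) * Y); last by field.
      by rewrite YE ach mulrC mulKf.
    * rewrite [X in acos X](_ : _ = cos (q * (2 * l))); first by rewrite ac2 mulrC mulKf.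
      have -> : q * (2 * l) = q * l + q * l by ring.
      by rewrite cosD; field.
  + rewrite /model_dist k0 -/q !euclid3_vec3 kE; split.
    * by rewrite [X in acos X](_ : _ = cos (q * l)); [rewrite acl mulrC mulKf|field].
    * by rewrite [X in acos X](_ : _ = cos (q * l)); [rewrite acl mulrC mulKf|field].
  + rewrite /model_dist /model_height k0 -/q !euclid3_vec3 -/Y {1}kE.
    by congr (acos _ / _); field.
- set q := Num.sqrt (- k); have q0 : 0 < q by rewrite sqrtr_gt0 oppr_gt0.
  have kE : k = - q ^+ 2 by rewrite sqr_sqrtr ?opprK// oppr_ge0 ltW.
  have k0' : 0 < k = false by apply/negbTE; rewrite -leNgt ltW.
  have ql0 : 0 <= q * l by rewrite mulr_ge0// ltW.
  have qh0 : 0 <= q * h by rewrite mulr_ge0// ltW.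
  have cl1 := cosh_ge1 (q * l); have ch1 := cosh_ge1 (q * h).
  have cl0 : 0 < cosh (q * l) by lra.
  have clh : cosh (q * l) <= cosh (q * h).
    rewrite !cosh_half lerD2l ler_pM2l// ler_sqr ?nnegrE ?sinh_ge0 ?divr_ge0//.
    have qlh : q * l / 2 <= q * h / 2 by rewrite ler_pM2r// ler_pM2l.
    by rewrite ler_pM2r// lerB// ler_expR//; lra.
  set Y := cosh (q * h) / cosh (q * l).
  have Y1 : 1 <= Y by rewrite ler_pdivlMr ?mul1r.
  have YE : cosh (q * l) * Y = cosh (q * h) by rewrite mulrC divfK ?gt_eqF.
  have Y2 : Num.sqrt (Y ^+ 2 - 1) ^+ 2 = Y ^+ 2 - 1.
    by rewrite sqr_sqrtr// subr_ge0 expr_ge1//; lra.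
  have sl := cosh2sinh2 (q * l).
  have ach := arcosh_cosh qh0; have acl := arcosh_cosh ql0.
  have ac2 : arcosh (cosh (q * (2 * l))) = q * (2 * l).
    by rewrite arcosh_cosh// !mulr_ge0// ltW.
  exists (vec3 (- sinh (q * l) / q) 0 (cosh (q * l) / q)),
         (vec3 0 (Num.sqrt (Y ^+ 2 - 1) / q) (Y / q)),
         (vec3 (sinh (q * l) / q) 0 (cosh (q * l) / q)), (vec3 0 0 q^-1).
  have qN0 : q != 0 by rewrite gt_eqF.
  have nq2 : - q ^+ 2 != 0 by rewrite oppr_eq0 expf_neq0.
  split.
  + split; rewrite /model_surface/= k0' k0 lorentz3_vec3 vec3_2;
      (split; last by [rewrite divr_gt0//; lra | rewrite invr_gt0]);
      rewrite kE; apply: (mulfI nq2); rewrite divff//.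
    * by transitivity (cosh (q * l) ^+ 2 - sinh (q * l) ^+ 2); [field|].
    * by transitivity (Y ^+ 2 - Num.sqrt (Y ^+ 2 - 1) ^+ 2); [field|rewrite Y2; ring].
    * by transitivity (cosh (q * l) ^+ 2 - sinh (q * l) ^+ 2); [field|].
    * by field.
  + rewrite /model_dist k0' k0 -/q !lorentz3_vec3 kE; split.
    * rewrite [X in arcosh X](_ : _ = cosh (q * l) * Y); last by field.
      by rewrite YE ach mulrC mulKf.
    * rewrite [X in arcosh X](_ : _ = cosh (q * l) * Y); last by field.
      by rewrite YE ach mulrC mulKf.
    * rewrite [X in arcosh X](_ : _ = cosh (q * (2 * l))); first by rewrite ac2 mulrC mulKf.
      have -> : q * (2 * l) = 2 * (q * l) by ring.
      by rewrite cosh2; field.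
  + rewrite /model_dist k0' k0 -/q !lorentz3_vec3 kE; split.
    * by rewrite [X in arcosh X](_ : _ = cosh (q * l)); [rewrite acl mulrC mulKf|field].
    * by rewrite [X in arcosh X](_ : _ = cosh (q * l)); [rewrite acl mulrC mulKf|field].
  + rewrite /model_dist /model_height k0' k0 -/q !lorentz3_vec3 -/Y {1}kE.
    by congr (arcosh _ / _); field.
- have hl : 0 <= h ^+ 2 - l ^+ 2 by rewrite subr_ge0 ler_sqr.
  exists (vec3 (- l) 0 0), (vec3 0 (Num.sqrt (h ^+ 2 - l ^+ 2)) 0), (vec3 l 0 0),
         (vec3 0 0 0).
  have sub (a b c a' b' c' : R) : vec3 a b c - vec3 a' b' c' = vec3 (a - a') (b - b') (c - c').
    by apply/rowP => i; rewrite !mxE; case: i => [[|[|[|//]]] ?].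
  rewrite /model_surface /model_height /model_dist -k0 ltxx/= !vec3_2 !sub !euclid3_vec3.
  set S := Num.sqrt (h ^+ 2 - l ^+ 2).
  have S0 : 0 <= S by exact: sqrtr_ge0.
  have S2 : S ^+ 2 = h ^+ 2 - l ^+ 2 by rewrite sqr_sqrtr.
  have sqrtE (a b : R) : 0 <= b -> a = b ^+ 2 -> Num.sqrt a = b.
    by move=> b0 ->; rewrite sqrtr_sqr ger0_norm.
  split=> //.
  + split; apply: sqrtE; rewrite ?mulr_ge0//.
    * by transitivity (l ^+ 2 + S ^+ 2); [ring|rewrite S2; ring].
    * by transitivity (l ^+ 2 + S ^+ 2); [ring|rewrite S2; ring].
    * by ring.
  + by split; apply: sqrtE => //; ring.
  + by apply: sqrtE => //; ring.
Qed.

Lemma model_height0 k l : 0 <= l -> (0 < k -> Num.sqrt k * l < pi / 2) ->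
  model_height k l l = 0.
Proof.
move=> l0 lk; have p0 := @pi_gt0 R; rewrite /model_height; case: (ltgtP 0 k) => [k0|k0|_].
- have c0 : 0 < cos (Num.sqrt k * l).
    apply: cos_gt0_pihalf; apply/andP; split; last exact: lk.
    by apply: (@lt_le_trans _ _ 0); [lra|rewrite mulr_ge0 ?sqrtr_ge0].
  by rewrite divff ?acos1 ?mul0r// gt_eqF.
- by rewrite divff ?gt_eqF ?(lt_le_trans ltr01 (cosh_ge1 _))// -cosh0 arcosh_cosh// mul0r.
- by rewrite subrr sqrtr0.
Qed.

(** At small scales the right triangle with legs [1 / 2] and [l],
    [l ^+ 2 = 1 / 2], has a hypotenuse shorter than [h], [h ^+ 2 > 3 / 4], also
    in the sphere and in the hyperbolic plane. *)
Section SmallRightTriangles.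
Variables h l d t : R.
Hypotheses (h0 : 0 <= h) (hE : h ^+ 2 = 3 / 4 + d) (d0 : 0 < d) (d1 : d <= 1).
Hypotheses (l0 : 0 <= l) (l2 : l ^+ 2 = 1 / 2) (t0 : 0 < t) (td : t <= d / 8).

Let h2 : h <= 2.
Proof. by rewrite -(@ler_sqr R) ?nnegrE// hE; move: d1; lra. Qed.

Let l1 : l <= 1.
Proof. by rewrite -(@ler_sqr R) ?nnegrE// l2; lra. Qed.

Let t8 : t <= 1 / 8. Proof. by move: td d1; lra. Qed.

Let tl0 : 0 <= t * l. Proof. by rewrite mulr_ge0// ltW. Qed.

Let tlt : t * l <= t. Proof. by rewrite ler_piMr// ltW. Qed.

Let th0 : 0 <= t * h. Proof. by rewrite mulr_ge0// ltW. Qed.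

Let tht : t * h <= t * 2. Proof. by rewrite ler_pM2l. Qed.

Let tt : 0 < t ^+ 2. Proof. by rewrite exprn_gt0. Qed.

Let tlE : (t * l) ^+ 2 = t ^+ 2 / 2. Proof. by rewrite exprMn l2; ring. Qed.

Let thE : (t * h) ^+ 2 = t ^+ 2 * (3 / 4 + d). Proof. by rewrite exprMn hE. Qed.

Let tmE : (t * (1 / 2)) ^+ 2 = t ^+ 2 / 4. Proof. by field. Qed.

Lemma cos_hypotenuse_lt : cos (t * h) < cos (t * (1 / 2)) * cos (t * l).
Proof.
have cl : 1 - t ^+ 2 / 2 / 2 <= cos (t * l).
  rewrite -tlE; apply: cos_ge_quadratic.
  by apply/andP; split; move: tl0 tlt t8; lra.
have cm : 1 - t ^+ 2 / 4 / 2 <= cos (t * (1 / 2)).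
  rewrite -tmE; apply: cos_ge_quadratic.
  by apply/andP; split; move: t0 t8; lra.
have ch : cos (t * h) <= 1 - t ^+ 2 * (3 / 4 + d) / 2 + t ^+ 2 * t ^+ 2 * (3 / 4 + d) ^+ 2 / 8.
  have -> : t ^+ 2 * t ^+ 2 * (3 / 4 + d) ^+ 2 = (t * h) ^+ 4 by rewrite -hE; ring.
  rewrite -thE; apply: cos_le_quartic.
  by apply/andP; split; move: th0 tht t8; lra.
apply: (le_lt_trans ch).
have t2 : t ^+ 2 <= d / 64.
  apply: (@le_trans _ _ (t * (d / 8))); first by rewrite expr2 ler_pM2l.
  by have : t * d <= 1 / 8 * d by [rewrite ler_pM2r]; lra.
apply: (@lt_le_trans _ _ ((1 - t ^+ 2 / 4 / 2) * (1 - t ^+ 2 / 2 / 2))); last first.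
  by apply: ler_pM => //; move: t2 d1; lra.
set T := t ^+ 2 in t2 *; have T0 : 0 < T by exact: tt.
have : T * (3 / 4 + d) ^+ 2 <= d / 64 * 4.
  apply: ler_pM; [exact: ltW|exact: sqr_ge0|exact: t2|].
  by move: d0 d1; nra.
by rewrite -(ler_pM2l T0); have := mulr_gt0 T0 d0; have := sqr_ge0 T; lra.
Qed.

Lemma cosh_hypotenuse_gt : cosh (t * (1 / 2)) * cosh (t * l) < cosh (t * h).
Proof.
have G x : 0 <= x -> x / 2 <= t -> ((1 - x / 2) ^+ 2)^-1 <= 1 + 4 * t.
  move=> x0 xt; have x1 : 0 < 1 - x / 2 by move: xt t8; lra.
  have c0 : 0 < 1 + 4 * t by move: t0; lra.
  rewrite invf_ple ?posrE ?exprn_gt0//.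
  have y0 : 0 <= 1 - t by move: t8; lra.
  have : (1 - t) ^+ 2 <= (1 - x / 2) ^+ 2.
    by rewrite ler_sqr ?nnegrE ?(ltW x1)//; move: xt; lra.
  apply: le_trans; rewrite -[leLHS]mul1r ler_pdivrMr//.
  by move: t0 t8; nra.
have cl : cosh (t * l) <= 1 + t ^+ 2 / 4 * (1 + 4 * t).
  have /cosh_bounds/andP[_ c] : 0 <= t * l < 2.
    by rewrite tl0/=; move: tlt t8; lra.
  apply: (le_trans c); rewrite tlE lerD2l.
  have -> : t ^+ 2 / 2 / 2 = t ^+ 2 / 4 by field.
  rewrite ler_wpM2l ?divr_ge0 ?sqr_ge0//; apply: G => //.
  by move: tlt t0; lra.
have cm : cosh (t * (1 / 2)) <= 1 + t ^+ 2 / 8 * (1 + 4 * t).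
  have m0 : 0 <= t * (1 / 2) by move: t0; lra.
  have /cosh_bounds/andP[_ c] : 0 <= t * (1 / 2) < 2.
    by rewrite m0/=; move: t8; lra.
  apply: (le_trans c); rewrite tmE lerD2l.
  have -> : t ^+ 2 / 4 / 2 = t ^+ 2 / 8 by field.
  rewrite ler_wpM2l ?divr_ge0 ?sqr_ge0//; apply: G => //.
  by move: t0; lra.
have ch : 1 + t ^+ 2 * (3 / 4 + d) / 2 * (1 - t) ^+ 2 <= cosh (t * h).
  have /cosh_bounds/andP[c _] : 0 <= t * h < 2.
    by rewrite th0/=; move: tht t8; lra.
  apply: le_trans c; rewrite thE lerD2l ler_wpM2l//.
    by rewrite divr_ge0// mulr_ge0 ?sqr_ge0//; move: d0; lra.
  by rewrite ler_sqr ?nnegrE; move: tht t8; lra.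
apply: lt_le_trans ch.
apply: (@le_lt_trans _ _ ((1 + t ^+ 2 / 8 * (1 + 4 * t)) * (1 + t ^+ 2 / 4 * (1 + 4 * t)))).
  by apply: ler_pM => //; apply: le_trans (cosh_ge1 _).
have E1 : (1 + 4 * t) ^+ 2 <= 4.
  have -> : 4 = 2 ^+ 2 :> R by ring.
  by rewrite ler_sqr ?nnegrE; move: t0 t8; lra.
have E2 : t ^+ 2 * (1 + 4 * t) ^+ 2 <= t / 2.
  apply: (@le_trans _ _ (t ^+ 2 * 4)); first by rewrite ler_pM2l.
  have : t * t <= t * (1 / 8) by rewrite ler_pM2l.
  by rewrite expr2; lra.
have E4 : (3 / 4 + d) * (1 - 2 * t) <= (3 / 4 + d) * (1 - t) ^+ 2.
  have dp : 0 < 3 / 4 + d by move: d0; lra.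
  by rewrite ler_pM2l// sqrrB !expr1n; move: tt; lra.
have E5 : 3 / 8 * (1 + 4 * t) + t ^+ 2 * (1 + 4 * t) ^+ 2 / 32 <
    (3 / 4 + d) * (1 - t) ^+ 2 / 2.
  have dt : d * t <= 1 * t by rewrite ler_pM2r.
  by move: E2 E4 dt td t0; lra.
move: E5; rewrite -(ltr_pM2l tt); lra.
Qed.

End SmallRightTriangles.

(** At small scales the triangle with legs [h], [h ^+ 2 > 3 / 4], and half-basis
    [Num.sqrt (1 / 2)] is higher than [1 / 2] in every model surface. *)
Lemma model_height_gt k (h d s : R) : 0 <= h -> h ^+ 2 = 3 / 4 + d -> 0 < d <= 1 ->
  0 < s -> Num.sqrt `|k| * s <= d / 8 ->
  s / 2 < model_height k (s * h) (s * Num.sqrt (1 / 2)).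
Proof.
move=> h0 hE /andP[d0 d1] s0.
set l := Num.sqrt (1 / 2).
have l0 : 0 <= l by exact: sqrtr_ge0.
have l2 : l ^+ 2 = 1 / 2 by rewrite sqr_sqrtr//; lra.
rewrite /model_height; case: (ltgtP 0 k) => [k0|k0|_].
- rewrite gtr0_norm//; set q := Num.sqrt k => qs.
  have q0 : 0 < q by rewrite sqrtr_gt0.
  rewrite ltr_pdivlMr// !mulrA.
  have -> : s / 2 * q = q * s * (1 / 2) by ring.
  set t := q * s in qs *; have t0 : 0 < t by rewrite mulr_gt0.
  have key := cos_hypotenuse_lt h0 hE d0 d1 l0 l2 t0 qs.
  have p2 := @pi_ge2 R.
  have small x : 0 <= x -> x <= 2 -> 0 <= t * x < pi / 2.
    move=> x0 x2; rewrite mulr_ge0 ?(ltW t0)//=.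
    have : t * x <= t * 2 by rewrite ler_pM2l.
    by move: qs d1 p2; lra.
  have h2 : h <= 2 by rewrite -(@ler_sqr R) ?nnegrE// hE; move: d1; lra.
  have l1 : l <= 2 by rewrite -(@ler_sqr R) ?nnegrE// l2; lra.
  have /andP[tl1 tl2] := small l l0 l1; have /andP[th1 th2] := small h h0 h2.
  have cl0 : 0 < cos (t * l).
    by apply: cos_gt0_pihalf; rewrite tl2 andbT; move: tl1 p2; lra.
  have ch0 : 0 <= cos (t * h).
    by apply: cos_ge0_pihalf; rewrite (ltW th2) andbT; move: th1 p2; lra.
  have Yl : cos (t * h) / cos (t * l) < cos (t * (1 / 2)) by rewrite ltr_pdivrMr.
  have Yb : -1 <= cos (t * h) / cos (t * l) <= 1.
    rewrite (le_trans (ltW Yl) (cos_le1 _)) andbT.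
    by apply: (@le_trans _ _ 0); [rewrite lerN10|rewrite divr_ge0 ?(ltW cl0)].
  rewrite -(@ltr_cos R) ?acosK// ?in_itv/= ?acos_ge0 ?acos_lepi//.
  by apply/andP; split; move: t0 qs d1 p2; lra.
- rewrite ltr0_norm//; set q := Num.sqrt (- k) => qs.
  have q0 : 0 < q by rewrite sqrtr_gt0 oppr_gt0.
  rewrite ltr_pdivlMr// !mulrA.
  have -> : s / 2 * q = q * s * (1 / 2) by ring.
  set t := q * s in qs *; have t0 : 0 < t by rewrite mulr_gt0.
  apply: arcosh_gt; first by move: t0; lra.
  rewrite ltr_pdivlMr ?(lt_le_trans ltr01 (cosh_ge1 _))//.
  exact: cosh_hypotenuse_gt h0 hE d0 d1 l0 l2 t0 qs.
- move=> _; have -> : (s * h) ^+ 2 - (s * l) ^+ 2 = s ^+ 2 * (1 / 4 + d).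
    by rewrite !exprMn hE l2; field.
  rewrite -(@ltr_sqr R) ?nnegrE ?sqrtr_ge0//; last by lra.
  rewrite sqr_sqrtr; last by rewrite mulr_ge0 ?sqr_ge0//; lra.
  have : 0 < s ^+ 2 * d by rewrite mulr_gt0// exprn_gt0.
  by rewrite expr_div_n; lra.
Qed.

End ModelTriangles.

(** * Two triangles near the zero measure *)

Section Triangles.
Variables (R : realType) (n : nat).
Local Notation M0 := {finite_measure set (Rn R n) -> \bar R}.
Local Notation hk := (@HK R n).
Local Notation l := (Num.sqrt (1 / 2) : R).
Implicit Types (x y : 'rV[R]_n).

Let l0 : 0 <= l. Proof. exact: sqrtr_ge0. Qed.

Let l2 : l ^+ 2 = 1 / 2. Proof. by rewrite sqr_sqrtr//; lra. Qed.

Let l1 : l < 1. Proof. by rewrite -(@ltr_sqr R) ?nnegrE// l2 expr1n; lra. Qed.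

Lemma sqrt_eq (a b : R) : 0 <= b -> a = b ^+ 2 -> Num.sqrt a = b.
Proof. by move=> b0 ->; rewrite sqrtr_sqr ger0_norm. Qed.

Lemma cos_pi4 : cos (pi / 4) = l.
Proof.
have p0 := @pi_gt0 R.
have c0 : 0 <= cos (pi / 4) :> R.
  by apply: cos_ge0_pihalf; apply/andP; split; lra.
apply/esym/sqrt_eq => //.
have s2 := cos2Dsin2 (pi / 4 : R).
have E : sin (pi / 4) = cos (pi / 4) :> R.
  by rewrite -cosBpihalf -cosN; congr cos; lra.
by rewrite E in s2; lra.
Qed.

Lemma angle_diag (u : R) : 0 < u -> angle u u = pi / 4.
Proof.
move=> u0; have p0 := @pi_gt0 R.
have E : Num.sqrt (u ^+ 2 + u ^+ 2) * l = u.
  rewrite -sqrtrM ?addr_ge0 ?sqr_ge0//; apply: sqrt_eq; first exact: ltW.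
  by field.
have r0 : 0 < Num.sqrt (u ^+ 2 + u ^+ 2) by rewrite sqrtr_gt0 addr_gt0 ?exprn_gt0.
rewrite /angle -{1}E mulrC mulKf ?gt_eqF// -cos_pi4 cosK//.
by rewrite in_itv/=; apply/andP; split; lra.
Qed.

(** The midpoint of the path of atoms between two atoms of mass [s ^+ 2] at
    distance [pi / 2]. *)
Lemma atom_path_mid x y (s : R) : 0 < s ->
  edist (x : Rn R n) (y : Rn R n) = pi / 2 ->
  atom_path x y s s (1 / 2) = cloud [:: (x + (1 / 2) *: (y - x) : Rn R n, s * l)].
Proof.
move=> s0 xy; have p0 := @pi_gt0 R.
rewrite /atom_path xy cos_pihalf sin_pihalf.
have -> : (1 - 1 / 2) * s + 1 / 2 * (s * 0) = s / 2 by field.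
have -> : 1 / 2 * (s * 1) = s / 2 by field.
rewrite /sector angle_diag ?divr_gt0// xy.
have -> : pi / 4 / (pi / 2) = 1 / 2 :> R.
  by move: (pi : R) p0 => P P0; field; rewrite gt_eqF.
suff -> : Num.sqrt ((s / 2) ^+ 2 + (s / 2) ^+ 2) = s * l by [].
apply: sqrt_eq; first by rewrite mulr_ge0// ltW.
by rewrite [RHS]exprMn l2; field.
Qed.

(** A path that changes the masses at [x] and [y] without transport. *)
Definition mass_path x y (a b a' b' t : R) : M0 :=
  cloud [:: (x : Rn R n, (1 - t) * a + t * a'); (y : Rn R n, (1 - t) * b + t * b')].

Section MassPath.
Variables (x y : 'rV[R]_n) (a b a' b' : R).
Hypothesis xy : edist (x : Rn R n) (y : Rn R n) = pi / 2.
Hypotheses (a0 : 0 <= a) (b0 : 0 <= b) (a'0 : 0 <= a') (b'0 : 0 <= b').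

Let conv_ge0 (u v t : R) : 0 <= u -> 0 <= v -> 0 <= t <= 1 -> 0 <= (1 - t) * u + t * v.
Proof. by move=> u0 v0 /andP[t0 t1]; rewrite addr_ge0// mulr_ge0// subr_ge0. Qed.

Lemma shortest_mass_path :
  let p := cloud [:: (x : Rn R n, a); (y : Rn R n, b)] : M0 in
  let q := cloud [:: (x : Rn R n, a'); (y : Rn R n, b')] : M0 in
  shortest_path hk p q (mass_path x y a b a' b')
  /\ hk p q = Num.sqrt ((a - a') ^+ 2 + (b - b') ^+ 2).
Proof.
have E0 : mass_path x y a b a' b' 0 = cloud [:: (x : Rn R n, a); (y : Rn R n, b)].
  by rewrite /mass_path subr0 !mul0r !mul1r !addr0.
have E1 : mass_path x y a b a' b' 1 = cloud [:: (x : Rn R n, a'); (y : Rn R n, b')].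
  by rewrite /mass_path subrr !mul0r !mul1r !add0r.
rewrite /= -E0 -E1; apply: shortest_path_isometric => s t s01 t01.
rewrite HK_two_atoms ?conv_ge0// -sqrtr_sqr -sqrtrM ?sqr_ge0//.
by congr Num.sqrt; ring.
Qed.

Lemma HK_nil_mass_path t : 0 <= t <= 1 ->
  hk (cloud [::]) (mass_path x y a b a' b' t) <= a + b + a' + b'.
Proof.
move=> t01; apply: le_trans (HK_nil_le _) _.
have A := conv_ge0 a0 a'0 t01; have B := conv_ge0 b0 b'0 t01.
case/andP: t01 => t0 t1.
have A' : (1 - t) * a + t * a' <= a + a' by apply: lerD; rewrite ler_piMl//; lra.
have B' : (1 - t) * b + t * b' <= b + b' by apply: lerD; rewrite ler_piMl//; lra.
have S0 : 0 <= a + b + a' + b' by rewrite !addr_ge0.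
rewrite big_cons big_seq1/=.
rewrite -[leRHS]ger0_norm// -sqrtr_sqr ler_sqrt ?sqr_ge0//.
move: (_ + t * a') (_ + t * b') A B A' B' => u v A B A' B'.
have : (u + v) ^+ 2 <= (a + b + a' + b') ^+ 2 by rewrite ler_sqr ?nnegrE ?addr_ge0//; lra.
have : 0 <= u * v by exact: mulr_ge0.
by rewrite sqrrD mulr2n; lra.
Qed.

End MassPath.

(** A scale at which paths between atoms of mass at most [s ^+ 2] stay within
    [e] of the zero measure, and which is small compared to the curvature radius
    of the model surface. *)
Lemma small_scale (k e d : R) : 0 < e -> 0 < d ->
  exists s : R, [/\ 0 < s, s + s < e & Num.sqrt `|k| * s <= d / 8].
Proof.
move=> e0 d0; have q0 : 0 <= Num.sqrt `|k| by exact: sqrtr_ge0.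
set q := Num.sqrt _ in q0 *.
exists (Num.min (e / 4) (d / (8 * (q + 1)))).
have A : 0 < d / (8 * (q + 1)) by rewrite divr_gt0//; lra.
split.
- by rewrite lt_min A andbT; lra.
- have : Num.min (e / 4) (d / (8 * (q + 1))) <= e / 4 by rewrite ge_min lexx.
  by lra.
- apply: (@le_trans _ _ (q * (d / (8 * (q + 1))))).
    by rewrite ler_wpM2l// ge_min lexx orbT.
  rewrite mulrA ler_pdivrMr; last by lra.
  have : 0 <= d by exact: ltW.
  by move=> d0'; have := mulr_ge0 q0 d0'; lra.
Qed.

(** At the scale [s] given by [small_scale], triangles with sides bounded by
    multiples of [s] are admissible for the comparison. *)
Lemma perimeter_small (k p s : R) : 0 < k -> Num.sqrt `|k| * s <= 1 / 8 ->
  p <= 8 * s -> p < 2 * pi / Num.sqrt k.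
Proof.
move=> k0; rewrite gtr0_norm// => ks ps; have p2 := @pi_ge2 R.
have q0 : 0 < Num.sqrt k by rewrite sqrtr_gt0.
rewrite ltr_pdivlMr//; have : p * Num.sqrt k <= 8 * s * Num.sqrt k by rewrite ler_pM2r.
lra.
Qed.

Lemma leg_small (k h s : R) : 0 < s -> 0 <= h <= 2 -> Num.sqrt `|k| * s <= 1 / 8 ->
  0 < k -> Num.sqrt k * (s * h) < pi / 2.
Proof.
move=> s0 /andP[h0 h2] ks k0; rewrite gtr0_norm// in ks; have p2 := @pi_ge2 R.
have : Num.sqrt k * s * h <= Num.sqrt k * s * 2.
  by rewrite ler_wpM2l// mulr_ge0 ?sqrtr_ge0// ltW.
by rewrite mulrA; lra.
Qed.

(** The two midpoints are distinct for [HK].  Weak duality applies with constant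
    potentials, equal to [cos (pi / 4)], because the midpoint of
    [x] and [y] is at distance [pi / 4] from both. *)
Lemma HK_pos x y (s : R) : edist (x : Rn R n) (y : Rn R n) = pi / 2 -> 0 < s ->
  0 < hk (cloud [:: (x : Rn R n, s / 2); (y : Rn R n, s / 2)])
         (cloud [:: (x + (1 / 2) *: (y - x) : Rn R n, s * l)]).
Proof.
move=> xy s0; have p0 := @pi_gt0 R.
rewrite HKE sqrtr_gt0 -lte_fin fineK ?HK2_fin//.
set m := x + _ *: _.
have lgt : 0 < l by rewrite sqrtr_gt0; lra.
have exm : edist (x : Rn R n) (m : Rn R n) = pi / 4.
  have := edist_line x y 0 (1 / 2); rewrite scale0r addr0 => ->.
  by rewrite xy sub0r normrN ger0_norm; lra.
have eym : edist (y : Rn R n) (m : Rn R n) = pi / 4.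
  have := edist_line x y 1 (1 / 2); rewrite scale1r addrC subrK => ->.
  by rewrite xy ger0_norm; lra.
have := @HK2_cloud_ge R n [:: (x : Rn R n, s / 2); (y : Rn R n, s / 2)]
  [:: (m : Rn R n, s * l)] (fun=> l) (fun=> l) (fun=> lgt) (fun=> lgt).
rewrite big_cons !big_seq1/= => H; apply: lt_le_trans (H _).
  rewrite lte_fin [(s * l) ^+ 2]exprMn l2.
  have : 0 < (1 - l) * s ^+ 2 by rewrite mulr_gt0 ?subr_gt0// exprn_gt0.
  by rewrite expr_div_n; lra.
have mp : Num.min (pi / 4) pi = pi / 4 :> R by apply/min_idPl; lra.
have K (a b : R) : 0 <= a -> 0 <= b ->
    2 * a * b * cos (Num.min (pi / 4) pi) <= l * a ^+ 2 + l * b ^+ 2.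
  move=> a0 b0; rewrite mp cos_pi4.
  by have := mulr_ge0 l0 (sqr_ge0 (a - b)); rewrite sqrrB mulr2n; lra.
move=> p q; rewrite !inE => /orP[]/eqP-> /eqP-> a b a0 b0 /=.
  by rewrite exm; exact: K.
by rewrite eym; exact: K.
Qed.

End Triangles.

Section Failure.
Variables (R : realType) (n : nat).
Local Notation M0 := {finite_measure set (Rn R n) -> \bar R}.
Local Notation hk := (@HK R n).
Local Notation l := (Num.sqrt (1 / 2) : R).

Let l0 : 0 <= l. Proof. exact: sqrtr_ge0. Qed.

Let l2 : l ^+ 2 = 1 / 2. Proof. by rewrite sqr_sqrtr//; lra. Qed.

Let l1 : l < 1. Proof. by rewrite -(@ltr_sqr R) ?nnegrE// l2 expr1n; lra. Qed.

Lemma edist_delta (i : 'I_n) (a : R) : 0 <= a ->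
  edist ((0 : 'rV[R]_n) : Rn R n) (a *: delta_mx 0 i : Rn R n) = a.
Proof.
move=> a0; apply: sqrt_eq => //; rewrite (bigD1 i)//= big1 => [|j ji].
  by rewrite !mxE !eqxx/=; ring.
by rewrite !mxE (negbTE ji) andbF mulr0 subrr expr0n.
Qed.

Lemma edist_delta2 (i j : 'I_n) (a b c d : R) : i != j ->
  edist ((a *: delta_mx 0 i + b *: delta_mx 0 j : 'rV[R]_n) : Rn R n)
        ((c *: delta_mx 0 i + d *: delta_mx 0 j : 'rV[R]_n) : Rn R n) =
  Num.sqrt ((a - c) ^+ 2 + (b - d) ^+ 2).
Proof.
move=> ij; congr Num.sqrt; have ji : j != i by rewrite eq_sym.
rewrite (bigD1 i)//= (bigD1 j)//= big1 => [|m /andP[mi mj]].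
  by rewrite !mxE !eqxx (negbTE ij) (negbTE ji) !andbF/=; ring.
by rewrite !mxE (negbTE mi) (negbTE mj) !andbF !mulr0 subrr expr0n.
Qed.

Lemma not_curvature_le (k : R) : (0 < n)%N -> ~ curvature_le hk k.
Proof.
have p2 := @pi_ge2 R.
have l02 : 0 <= l <= 2 by rewrite l0/=; apply: le_trans (ltW l1) _; lra.
have ball1 (s e : R) : s + s < e -> s + 0 + s / 2 + s / 2 < e by lra.
have ball2 (s e : R) : s + s < e -> s / 2 + s / 2 + 0 + s < e by lra.
have perimeter (u s : R) : 0 < s -> u <= s -> u + u + 2 * u <= 8 * s by lra.
move=> n0 H; pose i0 := Ordinal n0.
have [e e0 He] := H (cloud [::]).
have [s [s0 se ks]] := @small_scale R k e 1 e0 ltr01.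
pose x : 'rV[R]_n := 0; pose y : 'rV[R]_n := (pi / 2) *: delta_mx 0 i0.
have xy : edist (x : Rn R n) (y : Rn R n) = pi / 2.
  by apply: edist_delta; lra.
have xy0 : 0 < edist (x : Rn R n) (y : Rn R n) by rewrite xy; lra.
have xy1 : edist (x : Rn R n) (y : Rn R n) <= pi / 2 by rewrite xy.
pose a : M0 := cloud [:: (x : Rn R n, s)].
pose b : M0 := cloud [:: (x : Rn R n, s / 2); (y : Rn R n, s / 2)].
pose c : M0 := cloud [:: (y : Rn R n, s)].
have aE : a = cloud [:: (x : Rn R n, s); (y : Rn R n, 0)].
  apply: eq_finite_measure; apply/funext => A.
  by rewrite /a/= !cloud_EFin !big_cons !big_nil/= expr0n/= mul0r !addr0.
have cE : c = cloud [:: (x : Rn R n, 0); (y : Rn R n, s)].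
  apply: eq_finite_measure; apply/funext => A.
  by rewrite /c/= !cloud_EFin !big_cons !big_nil/= expr0n/= mul0r add0r !addr0.
have s0' := ltW s0; have s2 : 0 <= s / 2 by lra.
have [Pab Dab] := shortest_mass_path xy s0' (lexx 0) s2 s2.
have [Pbc Dbc] := shortest_mass_path xy s2 s2 (lexx 0) s0'.
have [Pac Dac] := shortest_atom_path s0 s0 xy0 xy1.
rewrite -aE -/b in Pab Dab; rewrite -cE -/b in Pbc Dbc.
rewrite -/a -/c xy cos_pihalf mulr0 subr0 in Pac Dac.
have Lab : hk a b = s * l.
  by rewrite Dab; apply: sqrt_eq; [rewrite mulr_ge0|rewrite exprMn l2; field].
have Lbc : hk b c = s * l.
  by rewrite Dbc; apply: sqrt_eq; [rewrite mulr_ge0|rewrite exprMn l2; field].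
have Lac : hk a c = 2 * (s * l).
  by rewrite Dac; apply: sqrt_eq; [rewrite !mulr_ge0|rewrite !exprMn l2; field].
have [Lam Lmc] := shortest_path_mid Pac Lac.
have sl : 0 <= s * l <= s * l by rewrite mulr_ge0 ?lexx.
have ksl := leg_small s0 l02 ks.
(* The legs and the half-basis have the same length, so the triangle is
   degenerate. *)
have [A [B [C [D [SM [AB BC AC] [AD DC] BD]]]]] := isosceles_triangle sl ksl.
have := He a b c _ _ _ Pab Pbc Pac _ _ _ _ (1 / 2) (half01 R) A B C D.
rewrite BD model_height0 ?mulr_ge0// atom_path_mid// => F.
have := HK_pos xy s0; rewrite ltNge => /negP; apply; apply: F.
- move=> t t01; apply: (le_lt_trans _ (ball1 _ _ se)).
  exact: HK_nil_mass_path.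
- move=> t t01; apply: (le_lt_trans _ (ball2 _ _ se)).
  exact: HK_nil_mass_path.
- move=> t t01; apply: (@le_lt_trans _ _ (s + s)) => //.
  exact: HK_nil_atom_path.
- move=> k0; apply: perimeter_small ks _ => //; rewrite Lab Lbc Lac.
  by apply: perimeter => //; exact: ler_piMr s0' (ltW l1).
- by rewrite -atom_path_mid// /comparison_config AB BC AC AD DC Lab Lbc Lac Lam Lmc.
Qed.

Lemma not_curvature_ge (k : R) : (1 < n)%N -> ~ curvature_ge hk k.
Proof.
have p2 := @pi_ge2 R.
have p42 : pi / 4 <= pi / 2 :> R by lra.
have p40 : 0 <= pi / 4 :> R by lra.
have ball1 (s e : R) : 0 < s -> s + s < e -> s + s / 2 < e by lra.
have ball2 (s e : R) : 0 < s -> s + s < e -> s / 2 + s < e by lra.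
have perimeter (u v s : R) : 0 < s -> u <= s * 2 -> v <= s -> u + u + 2 * v <= 8 * s.
  by lra.
move=> n1 H.
pose i0 := Ordinal (ltnW n1); pose i1 := Ordinal n1.
have i01 : i0 != i1 by [].
pose pt (u v : R) : 'rV[R]_n := u *: delta_mx 0 i0 + v *: delta_mx 0 i1.
pose x := pt 0 0; pose y := pt (pi / 2) 0; pose z := pt (pi / 4) (pi / 4).
pose w : R := Num.sqrt ((pi / 4) ^+ 2 + (pi / 4) ^+ 2).
have xy : edist (x : Rn R n) (y : Rn R n) = pi / 2.
  by rewrite edist_delta2//; apply: sqrt_eq; [lra|ring].
have xz : edist (x : Rn R n) (z : Rn R n) = w.
  by rewrite edist_delta2//; congr Num.sqrt; ring.
have zy : edist (z : Rn R n) (y : Rn R n) = w.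
  by rewrite edist_delta2//; congr Num.sqrt; field.
have w2 : w ^+ 2 = pi ^+ 2 / 8 by rewrite sqr_sqrtr ?addr_ge0 ?sqr_ge0//; field.
have pp : 0 < pi ^+ 2 :> R by rewrite exprn_gt0//; lra.
have w0 : 0 < w by rewrite sqrtr_gt0 addr_gt0// exprn_gt0//; lra.
have w1 : w <= pi / 2.
  by rewrite -(@ler_sqr R) ?nnegrE ?(ltW w0)//; [rewrite w2 expr_div_n|]; lra.
have w3 : pi / 3 < w.
  by rewrite -(@ltr_sqr R) ?nnegrE ?(ltW w0)//; [rewrite w2 expr_div_n|]; lra.
have cw : cos w < 1 / 2.
  by rewrite -cos_pi3 ltr_cos// in_itv/=; apply/andP; split; lra.
have cw0 : 0 <= cos w by apply: cos_ge0_pihalf; apply/andP; split; lra.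
pose d := 1 / 2 - cos w; pose h := Num.sqrt (5 / 4 - cos w).
have d01 : 0 < d <= 1 by rewrite /d; apply/andP; split; lra.
have h0 : 0 <= h by exact: sqrtr_ge0.
have hE : h ^+ 2 = 3 / 4 + d by rewrite sqr_sqrtr /d; lra.
have h2 : h <= 2 by rewrite -(@ler_sqr R) ?nnegrE//; lra.
have /andP[d0 d1] := d01; have d8 : d / 8 <= 1 / 8 by lra.
have lh : l <= h by rewrite -(@ler_sqr R) ?nnegrE// l2 hE; lra.
have [e e0 He] := H (cloud [::]).
have [s [s0 se ks]] := @small_scale R k e d e0 d0.
have s0' := ltW s0; have s2 : 0 < s / 2 by lra.
pose a : M0 := cloud [:: (x : Rn R n, s)].
pose b : M0 := cloud [:: (z : Rn R n, s / 2)].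
pose c : M0 := cloud [:: (y : Rn R n, s)].
have xy0 : 0 < edist (x : Rn R n) (y : Rn R n) by rewrite xy; lra.
have xy1 : edist (x : Rn R n) (y : Rn R n) <= pi / 2 by rewrite xy.
have xz0 : 0 < edist (x : Rn R n) (z : Rn R n) by rewrite xz.
have xz1 : edist (x : Rn R n) (z : Rn R n) <= pi / 2 by rewrite xz.
have zy0 : 0 < edist (z : Rn R n) (y : Rn R n) by rewrite zy.
have zy1 : edist (z : Rn R n) (y : Rn R n) <= pi / 2 by rewrite zy.
have [Pab Dab] := shortest_atom_path s0 s2 xz0 xz1.
have [Pbc Dbc] := shortest_atom_path s2 s0 zy0 zy1.
have [Pac Dac] := shortest_atom_path s0 s0 xy0 xy1.
rewrite -/a -/b xz in Pab Dab; rewrite -/b -/c zy in Pbc Dbc.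
rewrite -/a -/c xy cos_pihalf mulr0 subr0 in Pac Dac.
have Lab : hk a b = s * h.
  by rewrite Dab; apply: sqrt_eq; [rewrite mulr_ge0|rewrite [RHS]exprMn hE /d; field].
have Lbc : hk b c = s * h.
  by rewrite Dbc; apply: sqrt_eq; [rewrite mulr_ge0|rewrite [RHS]exprMn hE /d; field].
have Lac : hk a c = 2 * (s * l).
  by rewrite Dac; apply: sqrt_eq; [rewrite !mulr_ge0|rewrite !exprMn l2; field].
have [Lam Lmc] := shortest_path_mid Pac Lac.
have Lbm : hk b (atom_path x y s s (1 / 2)) = s / 2.
  rewrite atom_path_mid//.
  have -> : x + (1 / 2) *: (y - x) = pt (pi / 4) 0.
    by rewrite /x /y /pt !scale0r !addr0 add0r subr0 scalerA; congr (_ *: _); field.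
  have E : edist (z : Rn R n) (pt (pi / 4) 0 : Rn R n) = pi / 4.
    by rewrite edist_delta2//; apply: sqrt_eq; [exact: p40|ring].
  have E4 : edist (z : Rn R n) (pt (pi / 4) 0 : Rn R n) <= pi / 2 by rewrite E.
  have := HK_atom (ltW s2) (mulr_ge0 s0' l0) E4; rewrite E -/b => ->.
  apply: sqrt_eq; first exact: ltW.
  rewrite cos_pi4.
  by field.
have slh : 0 <= s * l <= s * h by rewrite mulr_ge0//= ler_pM2l.
have ks8 : Num.sqrt `|k| * s <= 1 / 8 by apply: le_trans ks _; exact: d8.
have h02 : 0 <= h <= 2 by rewrite h0.
have ksh := leg_small s0 h02 ks8.
have [A [B [C [D [SM [AB BC AC] [AD DC] BD]]]]] := isosceles_triangle slh ksh.
have := He a b c _ _ _ Pab Pbc Pac _ _ _ _ (1 / 2) (half01 R) A B C D.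
rewrite BD Lbm => F.
have := model_height_gt h0 hE d01 s0 ks; rewrite ltNge => /negP; apply; apply: F.
- move=> t t01; apply: (le_lt_trans _ (ball1 _ _ s0 se)).
  exact: HK_nil_atom_path.
- move=> t t01; apply: (le_lt_trans _ (ball2 _ _ s0 se)).
  exact: HK_nil_atom_path.
- move=> t t01; apply: (@le_lt_trans _ _ (s + s)) => //.
  exact: HK_nil_atom_path.
- move=> k0; apply: (perimeter_small k0 ks8); rewrite Lab Lbc Lac.
  by apply: perimeter => //; [rewrite ler_pM2l|exact: ler_piMr s0' (ltW l1)].
- by rewrite /comparison_config AB BC AC AD DC Lab Lbc Lac Lam Lmc.
Qed.

End Failure.

Theorem theorem5p18 (R : realType) (n : nat) :
  ((1 < n)%N -> forall k : R, ~ curvature_ge (@HK R n) k) /\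
  ((0 < n)%N -> forall k : R, ~ curvature_le (@HK R n) k).
Proof.
by split=> n0 k; [exact: not_curvature_ge|exact: not_curvature_le].
Qed.
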